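(* Let $0<d<1$, $0<\epsilon\ll1$ and $\epsilon\ll c_1<c_2<\infty$. Suppose $f(t)=\sum_{l=1}^N a_l(t)\cos(2\pi\phi_l(t))\in\mathcal{A}^{c_1,c_2}_{\epsilon,d}$ can be represented in a different form which is also in $\mathcal{A}^{c_1,c_2}_{\epsilon,d}$, that is, $$f(t)=\sum_{l=1}^N a_l(t)\cos(2\pi\phi_l(t))=\sum_{l=1}^M A_l(t)\cos(2\pi\varphi_l(t))\in\mathcal{A}^{c_1,c_2}_{\epsilon,d}.$$ Then $M=N$ and, for all $l=1,\dots,N$ and all $t\in\mathbb{R}$, $$|\phi_l(t)-\varphi_l(t)|\le E_I\epsilon,\qquad |\phi_l'(t)-\varphi_l'(t)|\le E_I\epsilon,\qquad |a_l(t)-A_l(t)|\le E_I\epsilon,$$ where $E_I>0$ is a finite universal constant depending on $c_1$, $c_2$ and $d$, namely $$E_I:=\max\big\{2\sqrt{c_2}\,E_m,\;2c_1^{-1}c_2^{3/2}(1+d)(\sqrt{1+d}+2)E_m,\;9\sqrt{c_2}\,E_m\big\},$$ with $E_m$ the constant given in the context.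
   Context: Class $\mathcal{A}^{c_1,c_2}_{\epsilon}$: functions $f:\mathbb{R}\to\mathbb{R}$, $f\in C^1(\mathbb{R})\cap L^\infty(\mathbb{R})$, of the form $f(t)=A(t)\cos(2\pi\phi(t))$ where $A,\phi:\mathbb{R}\to\mathbb{R}$ satisfy: $A\in C^1(\mathbb{R})\cap L^\infty(\mathbb{R})$, $\inf A>c_1$, $\sup A<c_2$; $\phi\in C^2(\mathbb{R})$, $\inf\phi'>c_1$, $\sup\phi'<c_2$; $|A'(t)|\le\epsilon\phi'(t)$ and $|\phi''(t)|\le\epsilon\phi'(t)$ for all $t\in\mathbb{R}$. Class $\mathcal{A}^{c_1,c_2}_{\epsilon,d}$: functions $f(t)=\sum_{k=1}^K f_k(t)$ for some finite $K>0$, where each $f_k(t)=A_k(t)\cos(2\pi\phi_k(t))\in\mathcal{A}^{c_1,c_2}_{\epsilon}$ and the phases satisfy, for $k=2,\dots,K$, $\phi_k'(t)>\phi_{k-1}'(t)$ and $\phi_k'(t)-\phi_{k-1}'(t)\ge d\,[\phi_k'(t)+\phi_{k-1}'(t)]$. Saying that a representation is in the class means that its amplitudes and phases satisfy these conditions. Constant $E_m$: let $\Delta=\frac{d}{2(1+d)}$, let $\psi$ be the Schwartz function with Fourier transform $\widehat\psi(\xi)=e\exp\big\{\frac{1}{((1-\xi)/\Delta)^2-1}\big\}$ for $\xi\in[1-\Delta,1+\Delta]$ and $0$ otherwise (where $\widehat h(\xi)=\int h(t)e^{-i2\pi\xi t}dt$), and let $I_i=\int|x|^i|\psi(x)|\,dx$.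 Then $$E_m=\frac{c_2}{c_1^{3/2}}\Big\lceil\frac{\ln c_2-\ln c_1}{\ln(1+d)-\ln(1-d)}\Big\rceil\Big\{I_1+\frac{I_2}{2c_1}+\pi\Big(\frac{c_2}{c_1}I_2+\frac{c_2}{3c_1^2}I_3\Big)\Big\}.$$
   Formalization: The phase bound is proved up to an integer n_l independent of t: |φ_l(t)−ϕ_l(t)−n_l| ≤ E_I ε. As stated it fails: replacing φ_l by φ_l+1 changes neither f nor membership in the class, yet the phases differ by 1. Here ε is below a threshold depending on c_1, c_2, d. *)

(* Defs.v *)
From HB Require Import structures.
From mathcomp Require Import all_boot all_order all_algebra.
From mathcomp Require Import all_classical all_reals all_analysis.
From mathcomp Require Import complex.

Set Implicit Arguments.
Unset Strict Implicit.
Unset Printing Implicit Defensive.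

Import Order.TTheory GRing.Theory Num.Theory.
Import numFieldNormedType.Exports.

Local Open Scope ring_scope.
Local Open Scope complex_scope.
Local Open Scope classical_set_scope.

Section Classes.
Variable R : realType.
Implicit Types (c eps d : R) (f A phi : R -> R).

Definition class_C (n : nat) f : Prop :=
  (forall (k : nat) (t : R), (k < n)%N -> derivable (derive1n k f) t 1) /\
  continuous (derive1n n f).

Definition bounded_Linfty f : Prop :=
  measurable_fun setT f /\ finite_norm (@lebesgue_measure R) +oo%E f.

(* Extended-real infimum and supremum: the real-valued sup of a set that is not
   bounded above is 0 by convention, which would make [sup g < c] hold for
   unbounded g. *)
Definition einf (g : R -> R) : \bar R := ereal_inf (range (EFin \o g)).
Definition esup (g : R -> R) : \bar R := ereal_sup (range (EFin \o g)).

Definition imf A phi : R -> R := fun t => A t * cos (2 * pi * phi t).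

Definition in_A_eps c1 c2 eps A phi : Prop :=
  [/\ class_C 1 (imf A phi) /\ bounded_Linfty (imf A phi),
      [/\ class_C 1 A, bounded_Linfty A,
          (c1%:E < einf A)%E & (esup A < c2%:E)%E],
      [/\ class_C 2 phi,
          (c1%:E < einf (derive1 phi))%E & (esup (derive1 phi) < c2%:E)%E],
      (forall t : R, `|derive1 A t| <= eps * derive1 phi t) &
      (forall t : R, `|derive1n 2 phi t| <= eps * derive1 phi t)].

(* [A] and [phi] list the K amplitudes and phases (indexed from 0) of a
   representation of f that belongs to the separated class. *)
Definition repr_in_A_eps_d c1 c2 eps d f (K : nat) (A phi : 'I_K -> R -> R)
    : Prop :=
  [/\ (0 < K)%N,
      (forall t : R, f t = \sum_(k < K) imf (A k) (phi k) t),
      (forall k : 'I_K, in_A_eps c1 c2 eps (A k) (phi k)) &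
      (forall i j : 'I_K, j = i.+1 :> nat -> forall t : R,
         derive1 (phi i) t < derive1 (phi j) t /\
         d * (derive1 (phi j) t + derive1 (phi i) t) <=
           derive1 (phi j) t - derive1 (phi i) t)].

End Classes.

Section Wavelet.
Variable R : realType.
Implicit Types (c d xi : R) (psi : R -> R[i]).

Definition schwartz_real (g : R -> R) : Prop :=
  (forall (n : nat) (t : R), derivable (derive1n n g) t 1) /\
  (forall m n : nat, exists C : R, forall t : R,
     `|t| ^+ m * `|derive1n n g t| <= C).

Definition schwartz psi : Prop :=
  schwartz_real (fun t => complex.Re (psi t)) /\
  schwartz_real (fun t => complex.Im (psi t)).

Definition expi (x : R) : R[i] := cos x +i* sin x.

Definition integralC (h : R -> R[i]) : R[i] :=
  Rintegral (@lebesgue_measure R) setT (fun t => complex.Re (h t)) +i*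
  Rintegral (@lebesgue_measure R) setT (fun t => complex.Im (h t)).

Definition fourier psi xi : R[i] :=
  integralC (fun t => psi t * expi (- (2 * pi * xi * t))).

Definition Delta d : R := d / (2 * (1 + d)).

(* At the endpoints 1 - Delta d and 1 + Delta d the exponent is 1 / 0, read as
   -oo, so the value there is 0. Since 0^-1 = 0 in a field type, the endpoints
   are excluded from the first branch. *)
Definition psi_hat d xi : R :=
  if (1 - Delta d < xi < 1 + Delta d)
  then expR 1 * expR (1 / (((1 - xi) / Delta d) ^+ 2 - 1))
  else 0.

(* psi_hat is not even, so psi is complex-valued. *)
Definition is_wavelet d psi : Prop :=
  schwartz psi /\ forall xi, fourier psi xi = (psi_hat d xi)%:C.

Definition absmoment psi (i : nat) : \bar R :=
  (\int[@lebesgue_measure R]_x (`|x| ^+ i * Normc.normc (psi x))%:E)%E.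

Definition I_ psi (i : nat) : R := fine (absmoment psi i).

Definition E_m c1 c2 d psi : R :=
  c2 / c1 `^ (3 / 2) *
  (Num.ceil ((ln c2 - ln c1) / (ln (1 + d) - ln (1 - d))))%:~R *
  (I_ psi 1 + I_ psi 2 / (2 * c1) +
   pi * (c2 / c1 * I_ psi 2 + c2 / (3 * c1 ^+ 2) * I_ psi 3)).

Definition E_I c1 c2 d psi : R :=
  Num.max (2 * Num.sqrt c2 * E_m c1 c2 d psi)
  (Num.max (2 * c1^-1 * c2 `^ (3 / 2) * (1 + d) * (Num.sqrt (1 + d) + 2) *
              E_m c1 c2 d psi)
           (9 * Num.sqrt c2 * E_m c1 c2 d psi)).

End Wavelet.

(* Main.v *)
Require Import Defs.
From HB Require Import structures.
From mathcomp Require Import all_boot all_order all_algebra.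
From mathcomp Require Import all_classical all_reals all_analysis.
From mathcomp Require Import measurable_realfun complex ring lra.

Import Order.TTheory GRing.Theory Num.Theory.
Import numFieldNormedType.Exports.

Local Open Scope ring_scope.
Local Open Scope classical_set_scope.

(** Integrate f(b + s/x) against a kernel h(s) whose Fourier transform H is real
    and lives near 1. For a representation f = sum_k A_k cos(2 pi phi_k), freezing
    A_k and phi_k' at time b costs O(eps), so the result is, up to O(eps),
    sum_k A_k(b) exp(-2 pi i phi_k(b)) H(phi_k'(b)/x) / 2. Comparing two
    representations:
    - with h = psi and x = phi_l'(b), some frequency of the other representation
      must be within a factor 1 +- Delta of phi_l'(b). Since frequencies within
      one representation are separated by the factor 1/(1 - 4 Delta), this matching
      is increasing, hence M = N and l is matched with l;
    - with h = g := psi (1 - cos(4 pi Delta s)), whose transform still isolates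
      the matched pair and agrees with that of psi there, one gets
      |a_l - A_l| <= dl and a_l |sin(2 pi (phi_l - vphi_l))| <= dl, where dl
      involves the moments of |g| of orders 1 and 2. These are at most twice the
      same moments of |psi|, but also at most pi times the moments of |psi| of
      order one higher. The second bound is what makes the phase estimate, which
      divides dl by c1, fit under E_I when c1 is small: there the terms
      I_2/(2 c_1) and I_3 c_2/(3 c_1^2) of E_m dominate;
    - phi_l - vphi_l is O(eps) up to a constant integer and has second derivative
      O(eps), so by Landau's inequality phi_l' - vphi_l' is O(eps). *)

(** * Calculus *)

Lemma mean_value_shift {R : realType} (f df : R -> R) :
  (forall t : R, is_derive t (1 : R) f (df t)) ->
  forall b h : R, exists theta : R,
    (0 <= theta <= 1) /\ f (b + h) - f b = df (b + theta * h) * h.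
Proof.
move=> fdf b h.
have cf : continuous f.
  move=> t; apply: differentiable_continuous; apply/derivable1_diffP.
  by have [] := fdf t.
have [h0|h0|->] := ltgtP h 0; last first.
- by exists 0; rewrite lexx ler01 addr0 subrr mulr0.
- have [c] := @MVT R f df b (b + h) ltac:(lra) (fun t _ => fdf t)
    (continuous_subspaceT cf).
  rewrite in_itv /= => /andP[c1 c2] ->.
  exists ((c - b) / h); split.
    by rewrite divr_ge0 ?ler_pdivrMr//=; lra.
  by rewrite divfK ?gt_eqF//; congr (df _ * _); lra.
- have [c] := @MVT R f df (b + h) b ltac:(lra) (fun t _ => fdf t)
    (continuous_subspaceT cf).
  rewrite in_itv /= => /andP[c1 c2] E.
  exists ((c - b) / h); split.
    by rewrite ler_ndivrMr ?ler_ndivlMr//=; lra.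
  rewrite divfK ?lt_eqF//; rewrite (_ : b + (c - b) = c); last by lra.
  by rewrite -opprB E; lra.
Qed.

Lemma derivable_is_derive1 {R : realType} (f : R -> R) :
  (forall t : R, derivable f t 1) ->
  forall t : R, is_derive t (1 : R) f (f^`() t).
Proof. by move=> df t; rewrite derive1E; exact: DeriveDef. Qed.

Lemma lipschitz_of_derive {R : realType} (f df : R -> R) (M : R) :
  (forall t : R, is_derive t (1 : R) f (df t)) ->
  (forall t : R, `|df t| <= M) ->
  forall x y : R, `|f x - f y| <= M * `|x - y|.
Proof.
move=> fdf dfM x y.
have [th [_]] := mean_value_shift f df fdf y (x - y).
by rewrite (addrC y) subrK => ->; rewrite normrM ler_wpM2r.
Qed.

(** A Lipschitz derivative suffices. For each sign [s], the function [M / 2 * (t - b)^2 - s * (f t -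
    f b - df b * (t - b))] vanishes at [b] and its derivative has the sign of [t - b], so the mean
    value theorem makes it nonnegative on both sides of [b]. *)
Lemma second_order_taylor {R : realType} (f df : R -> R) (M : R) :
  (forall t : R, is_derive t (1 : R) f (df t)) ->
  (forall x y : R, `|df x - df y| <= M * `|x - y|) ->
  forall b h : R, `|f (b + h) - f b - df b * h| <= M * h ^+ 2 / 2.
Proof.
move=> fdf dfM b h.
have key (s : R) : `|s| = 1 ->
    s * (f (b + h) - f b - df b * h) <= M * h ^+ 2 / 2.
  move=> s1.
  pose g (t : R) := M / 2 * (t - b) ^+ 2 - s * (f t - f b - df b * (t - b)).
  pose dg (t : R) := M * (t - b) - s * (df t - df b).
  have gdg (t : R) : is_derive t (1 : R) g (dg t).
    have ft := fdf t.
    rewrite /g; apply: is_derive_eq.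
    rewrite /dg ?scaler0 ?addr0 ?subr0 ?scale1r /GRing.scale/=. lra.
  have [th [/andP[th0 th1]]] := mean_value_shift g dg gdg b h.
  rewrite /g /dg.
  have -> : b + h - b = h by lra.
  have -> : b + th * h - b = th * h by lra.
  rewrite subrr expr0n/= => E.
  have : 0 <= (M * (th * h) - s * (df (b + th * h) - df b)) * h.
    have B := dfM (b + th * h) b.
    rewrite (_ : b + th * h - b = th * h) in B; last by lra.
    have : `|s * (df (b + th * h) - df b) * h| <= M * (th * h) * h.
      rewrite !normrM s1 mul1r (le_trans (ler_wpM2r _ B))//.
      by rewrite normrM (ger0_norm th0) -!mulrA -normrM -expr2 ger0_norm ?sqr_ge0// lexx.
    by rewrite ler_norml => /andP[_ ?]; lra.
  by rewrite -E; lra.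
rewrite ler_norml; apply/andP; split.
- by have := key (-1) ltac:(by rewrite normrN1); lra.
- by have := key 1 ltac:(by rewrite normr1); lra.
Qed.

Lemma cos_lipschitz {R : realType} (x y : R) : `|cos x - cos y| <= `|x - y|.
Proof.
rewrite -[leRHS]mul1r.
apply: (@lipschitz_of_derive R cos (fun t => - sin t)) => t.
by rewrite normrN sin_max.
Qed.

Lemma sin_lipschitz {R : realType} (x y : R) : `|sin x - sin y| <= `|x - y|.
Proof.
rewrite -[leRHS]mul1r.
by apply: (@lipschitz_of_derive R sin cos) => t; exact: cos_max.
Qed.

(** The mean value theorem gives [sin u = u * cos (th * u)] with [th] in [0, 1], and cosine
    decreases on [0, pi]. *)
Lemma mul_cos_le_sin {R : realType} (u : R) :
  0 <= u <= pi / 2 -> u * cos u <= sin u.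
Proof.
move=> /andP[u0 u1].
have [th [/andP[t0 t1]]] := @mean_value_shift R sin cos _ 0 u.
rewrite sin0 subr0 !add0r mulrC => ->.
rewrite ler_wpM2l//.
have [->|tne1] := eqVneq th 1; first by rewrite mul1r.
have [->|une0] := eqVneq u 0; first by rewrite mulr0.
have u_gt0 : 0 < u by rewrite lt_def une0.
apply/ltW; rewrite ltr_cos ?in_itv/=.
- by rewrite gtr_pMl// lt_def eq_sym tne1.
- by rewrite mulr_ge0//= (le_trans (ler_piMl _ _))// (le_trans u1)//;
    have := @pi_ge0 R; lra.
- by rewrite u0 (le_trans u1)// ler_pdivrMr//; have := @pi_ge0 R; lra.
Qed.

Lemma cos_add_int {R : realType} (x : R) (n : int) :
  cos (2 * pi * (x + n%:~R)) = cos (2 * pi * x).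
Proof.
have key (k : nat) (y : R) : cos (2 * pi * (y + k%:R)) = cos (2 * pi * y).
  rewrite mulrDr -[RHS](periodicn (@cosD2pi R) k).
  by congr (cos (_ + _)); rewrite -mulr_natr -[pi *+ 2]mulr_natr; lra.
case: (intP n) => [|k|k]; first by rewrite addr0.
- exact: key.
- by rewrite -(key k.+1) rmorphN/= subrK.
Qed.

Lemma sin_add_int {R : realType} (x : R) (n : int) :
  sin (2 * pi * (x + n%:~R)) = sin (2 * pi * x).
Proof.
have key (k : nat) (y : R) : sin (2 * pi * (y + k%:R)) = sin (2 * pi * y).
  rewrite mulrDr -[RHS](periodicn (@sinD2pi R) k).
  by congr (sin (_ + _)); rewrite -mulr_natr -[pi *+ 2]mulr_natr; lra.
case: (intP n) => [|k|k]; first by rewrite addr0.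
- exact: key.
- by rewrite -(key k.+1) rmorphN/= subrK.
Qed.

(** A small sine leaves integers and half-integers as candidates for the neighbour of 2x; the
    positive cosine keeps [u = 2 * pi * |x - n|] within [0, pi/2]. There [sin u <= 3/5] forces
    [cos u >= 4/5], and [u * cos u <= sin u] yields the factor 5/4. *)
Lemma near_integer_of_sin_small {R : realType} (x s : R) :
  `|sin (2 * pi * x)| <= s -> s <= 3 / 5 -> 0 < cos (2 * pi * x) ->
  exists n : int, 2 * pi * `|x - n%:~R| <= 5 / 4 * s.
Proof.
move=> sins s35 cosx.
pose n : int := Num.floor (x + 1 / 2).
have [n1 n2] : n%:~R <= x + 1 / 2 /\ x + 1 / 2 < n%:~R + 1.
  by have /andP[? ] := Num.Theory.floor_itv (x + 1 / 2); rewrite intrD.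
exists n; set v := `|_|.
have pi0 := @pi_gt0 R.
have v12 : v <= 1 / 2 by rewrite /v ler_norml; apply/andP; split; lra.
have v0 : 0 <= v by exact: normr_ge0.
have cosv : cos (2 * pi * v) = cos (2 * pi * x).
  rewrite /v -[in RHS](cos_add_int x (- n)) rmorphN/=.
  by case: (ger0P (x - n%:~R)) => _; rewrite ?mulrN ?cosN.
have sinv : `|sin (2 * pi * v)| = `|sin (2 * pi * x)|.
  rewrite /v -[in RHS](sin_add_int x (- n)) rmorphN/=.
  by case: (ger0P (x - n%:~R)) => _; rewrite ?mulrN ?sinN ?normrN.
have v14 : 2 * pi * v <= pi / 2.
  rewrite leNgt; apply/negP => H.
  suff : cos (2 * pi * v) <= 0 by rewrite cosv; lra.
  have -> : 2 * pi * v = (2 * pi * v - pi) + pi by lra.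
  rewrite cosDpi oppr_le0 cos_ge0_pihalf//.
  apply/andP; split; first lra.
  have : 2 * pi * v <= 2 * pi * (1 / 2) by rewrite ler_wpM2l//; lra.
  lra.
have u0 : 0 <= 2 * pi * v by rewrite !mulr_ge0// ltW.
have := mul_cos_le_sin (2 * pi * v); rewrite u0 v14 => /(_ isT).
set u := 2 * pi * v in u0 v14 cosv sinv *.
have s0 : 0 <= sin u by rewrite sin_ge0_pi// u0/=; lra.
have su : sin u <= s by rewrite -(ger0_norm s0) sinv.
have cu : 4 / 5 <= cos u.
  have cu0 : 0 <= cos u by rewrite cosv ltW.
  have := cos2Dsin2 u.
  have : sin u ^+ 2 <= 9 / 25.
    have -> : (9 / 25 : R) = (3 / 5) ^+ 2 by lra.
    by rewrite ler_pXn2r ?nnegrE//; lra.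
  rewrite leNgt => h1 h2; apply/negP => h3.
  have : cos u ^+ 2 < 16 / 25.
    have -> : (16 / 25 : R) = (4 / 5) ^+ 2 by lra.
    by rewrite ltr_pXn2r ?nnegrE//; lra.
  lra.
have : u * (4 / 5) <= u * cos u by rewrite ler_wpM2l.
lra.
Qed.

(** If the nearby integer changed, the intermediate value theorem would give a point where [g]
    equals an integer plus 1/2, at distance at least 1/2 from every integer. *)
Lemma close_integer_constant {R : realType} (g : R -> R) (eta : R) :
  continuous g -> eta < 1 / 2 ->
  (forall t, exists n : int, `|g t - n%:~R| <= eta) ->
  exists n : int, forall t, `|g t - n%:~R| <= eta.
Proof.
move=> cg eta2 gn.
have [n0 hn0] := gn 0.
exists n0 => t.
have [n hn] := gn t.
suff -> : n0 = n by [].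
have ivt (a b v : R) : Num.min (g a) (g b) <= v <= Num.max (g a) (g b) ->
    exists c, g c = v.
  move=> hv.
  have [ab|ba] := leP a b.
    have [c _ <-] := IVT ab (continuous_subspaceT cg) hv.
    by exists c.
  have [c _ <-] := @IVT R g b a v (ltW ba) (continuous_subspaceT cg)
    ltac:(by rewrite minC maxC).
  by exists c.
have between (k m : int) (a b : R) : `|g a - k%:~R| <= eta ->
    `|g b - m%:~R| <= eta -> (k < m)%R -> False.
  rewrite !ler_norml => /andP[a1 a2] /andP[b1 b2] km.
  have km1 : k%:~R + 1 <= m%:~R :> R by rewrite -[1]/(1%:~R) -intrD ler_int lezD1.
  have [|c gc] := ivt a b (k%:~R + 1 / 2).
    rewrite ge_min le_max; apply/andP; split; apply/orP; [left|right]; lra.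
  have [p] := gn c; rewrite gc ler_norml => /andP[p1 p2].
  have kp : (k < p)%R by rewrite -(ltr_int R); lra.
  have : k%:~R + 1 <= p%:~R :> R by rewrite -[1]/(1%:~R) -intrD ler_int lezD1.
  lra.
have [lt|lt|//] := ltgtP n0 n.
- by have := between _ _ _ _ hn0 hn lt.
- by have := between _ _ _ _ hn hn0 lt.
Qed.

(** * Integration *)

Definition integ {R : realType} (f : R -> R) : Prop :=
  (@lebesgue_measure R).-integrable setT (EFin \o f).

Definition Int {R : realType} (f : R -> R) : R :=
  Rintegral (@lebesgue_measure R) setT f.

Section Integration.
Context {R : realType}.
Implicit Types f g : R -> R.

Lemma integ_measurable f : integ f -> measurable_fun setT f.
Proof. by move=> /measurable_int /measurable_EFinP. Qed.

Lemma integ_le f g : measurable_fun setT f -> integ g ->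
  (forall x, `|f x| <= g x) -> integ f.
Proof.
move=> mf ig fg; apply: le_integrable ig => //; first exact/measurable_EFinP.
by move=> x _ /=; rewrite lee_fin (le_trans (fg x))// ler_norm.
Qed.

Lemma integ_eq f g : f =1 g -> integ f -> integ g.
Proof. by move=> /funext ->. Qed.

Lemma integD f g : integ f -> integ g -> integ (fun x => f x + g x).
Proof. by move=> If Ig; have := integrableD measurableT If Ig. Qed.

Lemma integZ (k : R) f : integ f -> integ (fun x => k * f x).
Proof. by move=> If; have := integrableZl measurableT k If. Qed.

Lemma integB f g : integ f -> integ g -> integ (fun x => f x - g x).
Proof. by move=> If Ig; have := integrableB measurableT If Ig. Qed.

Lemma integ0 : integ (fun _ : R => 0).
Proof. exact: integrable0. Qed.

Lemma integ_sum n (F : 'I_n -> R -> R) : (forall i, integ (F i)) ->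
  integ (fun x => \sum_(i < n) F i x).
Proof.
elim: n F => [|n IH] F iF.
  by apply: integ_eq integ0 => x; rewrite big_ord0.
have := integD _ _ (IH (fun i => F (widen_ord (leqnSn n) i)) (fun i => iF _))
  (iF ord_max).
by apply: integ_eq => x; rewrite big_ord_recr.
Qed.

Lemma IntD f g : integ f -> integ g ->
  Int (fun x => f x + g x) = Int f + Int g.
Proof. by move=> If Ig; exact: RintegralD. Qed.

Lemma IntB f g : integ f -> integ g ->
  Int (fun x => f x - g x) = Int f - Int g.
Proof. by move=> If Ig; exact: RintegralB. Qed.

Lemma IntZ (k : R) f : integ f -> Int (fun x => k * f x) = k * Int f.
Proof. by move=> If; exact: RintegralZl. Qed.

Lemma Int_eq f g : f =1 g -> Int f = Int g.
Proof. by move=> /funext ->. Qed.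

Lemma Int0 : Int (fun _ : R => 0) = 0.
Proof. by rewrite /Int /Rintegral integral0. Qed.

Lemma Int_sum n (F : 'I_n -> R -> R) : (forall i, integ (F i)) ->
  Int (fun x => \sum_(i < n) F i x) = \sum_(i < n) Int (F i).
Proof.
elim: n F => [|n IH] F iF.
  rewrite big_ord0; transitivity (Int (fun _ : R => 0)); last exact: Int0.
  by apply: Int_eq => x; rewrite big_ord0.
rewrite big_ord_recr/= -IH// -IntD//; last exact: integ_sum.
by apply: Int_eq => x; rewrite big_ord_recr.
Qed.

Lemma Int_ge0 f : (forall x, 0 <= f x) -> 0 <= Int f.
Proof. by move=> f0; apply: Rintegral_ge0 => x _; exact: f0. Qed.

Lemma le_Int f g : integ f -> integ g -> (forall x, f x <= g x) ->
  Int f <= Int g.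
Proof. by move=> If Ig fg; apply: le_Rintegral => // x _; exact: fg. Qed.

Lemma norm_Int_le f g : integ f -> integ g ->
  (forall x, `|f x| <= g x) -> `|Int f| <= Int g.
Proof.
move=> If Ig fg; rewrite ler_norml; apply/andP; split.
  rewrite -mulN1r -IntZ//; apply: le_Int => //; first exact: integZ.
  by move=> x; have := fg x; rewrite ler_norml mulN1r => /andP[].
by apply: le_Int => // x; have := fg x; rewrite ler_norml => /andP[].
Qed.

(** The dominating function for the moments of Schwartz functions. Evenness reduces it to the
    integral over the half-line. *)
Lemma integ_oneDsqrV : integ (fun x : R => (1 + x ^+ 2)^-1).
Proof.
apply/integrableP; split.
  apply/measurable_EFinP; apply: continuous_measurable_fun.
  exact: continuous_oneDsqrV.
under eq_integral do rewrite /= ger0_norm ?invr_ge0 ?addr_ge0 ?sqr_ge0//.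
rewrite ge0_symfun_integralT//=.
- have -> : [set x : R | 0 <= x] = `[0, +oo[%classic.
    by apply/seteqP; split => x /=; rewrite in_itv/= ?andbT.
  by rewrite integral0y_oneDsqr -EFinM ltry.
- by move=> x; rewrite invr_ge0 addr_ge0 ?sqr_ge0.
- exact: continuous_oneDsqrV.
- by move=> x /=; rewrite sqrrN.
Qed.

Lemma continuous_of_derivable f : (forall t : R, derivable f t 1) -> continuous f.
Proof.
by move=> df t; apply: differentiable_continuous; exact/derivable1_diffP.
Qed.

Lemma measurable_of_derivable f :
  (forall t : R, derivable f t 1) -> measurable_fun setT f.
Proof.
by move=> /continuous_of_derivable ?; exact: continuous_measurable_fun.
Qed.

(** Adding the decay bounds of orders [i] and [i + 2] shows that [(1 + x^2) * |x|^i * |f x|] is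
    bounded. *)
Lemma schwartz_moment f i : schwartz_real f -> integ (fun x => `|x| ^+ i * `|f x|).
Proof.
move=> [df bf].
have [C0 h0] := bf i 0%N; have [C2 h2] := bf i.+2 0%N.
apply: (integ_le _ (fun x : R => (C0 + C2) * (1 + x ^+ 2)^-1)).
- apply: measurable_funM.
    by apply: measurable_funX; exact: normr_measurable.
  by apply: measurableT_comp => //; exact: measurable_of_derivable (df 0%N).
- exact: integZ integ_oneDsqrV.
- move=> x; rewrite ger0_norm ?mulr_ge0 ?exprn_ge0//.
  rewrite ler_pdivlMr ?ltr_pwDl ?sqr_ge0// mulrDr mulr1 lerD//.
  have := h2 x; rewrite /derive1n/= => h2x; rewrite (le_trans _ h2x)//.
  by rewrite -real_normK ?num_real// mulrAC -exprD addn2 lexx.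
Qed.

End Integration.

(** * Kernels and their modulation *)

(* [p] and [q] are the real and imaginary parts of an integrable function,
   [w] dominates its modulus, and [H] is its Fourier transform, which is
   assumed to be real-valued. *)
Record kernel {R : realType} (p q w H : R -> R) : Prop := Kernel {
  kernel_measurable_re : measurable_fun setT p;
  kernel_measurable_im : measurable_fun setT q;
  kernel_bound : forall u v s : R, u ^+ 2 + v ^+ 2 = 1 ->
    `|u * p s + v * q s| <= w s;
  kernel_integ0 : integ w;
  kernel_integ1 : integ (fun s => `|s| * w s);
  kernel_integ2 : integ (fun s => s ^+ 2 * w s);
  kernel_re_cos : forall r : R,
    Int (fun s => p s * cos (2 * pi * r * s)) = (H r + H (- r)) / 2;
  kernel_re_sin : forall r : R, Int (fun s => p s * sin (2 * pi * r * s)) = 0;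
  kernel_im_cos : forall r : R, Int (fun s => q s * cos (2 * pi * r * s)) = 0;
  kernel_im_sin : forall r : R,
    Int (fun s => q s * sin (2 * pi * r * s)) = (H r - H (- r)) / 2 }.

Section Kernel.
Context {R : realType} (p q w H : R -> R) (K : kernel p q w H).

Lemma kernel_re_le s : `|p s| <= w s.
Proof.
have := kernel_bound _ _ _ _ K 1 0 s; rewrite mul1r mul0r addr0; apply.
by rewrite expr1n expr0n addr0.
Qed.

Lemma kernel_im_le s : `|q s| <= w s.
Proof.
have := kernel_bound _ _ _ _ K 0 1 s; rewrite mul1r mul0r add0r; apply.
by rewrite expr1n expr0n add0r.
Qed.

Lemma kernel_weight_ge0 s : 0 <= w s.
Proof. exact: le_trans (normr_ge0 _) (kernel_re_le s). Qed.

Lemma kernel_integ_mul_bounded (g h : R -> R) (C : R) :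
  measurable_fun setT g -> (forall s, `|g s| <= w s) ->
  measurable_fun setT h -> (forall s, `|h s| <= C) ->
  integ (fun s => g s * h s).
Proof.
move=> mg gw mh hC.
apply: (integ_le _ (fun s => C * w s)).
- exact: measurable_funM.
- exact: integZ (kernel_integ0 _ _ _ _ K).
- by move=> s; rewrite normrM mulrC ler_pM.
Qed.

End Kernel.

Lemma measurable_cos_mul {R : realType} (c : R) :
  measurable_fun setT (fun s => cos (c * s)).
Proof. by apply: measurable_of_derivable => t; apply: ex_derive. Qed.

Lemma measurable_sin_mul {R : realType} (c : R) :
  measurable_fun setT (fun s => sin (c * s)).
Proof. by apply: measurable_of_derivable => t; apply: ex_derive. Qed.

Definition modulation {R : realType} (eta s : R) : R :=
  1 - cos (2 * pi * eta * s).

(** The Fourier transform of a kernel multiplied by [modulation eta]: the cosine is half the sum of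
    two characters, which translate [H] by [eta] either way. *)
Definition modulated_hat {R : realType} (H : R -> R) (eta r : R) : R :=
  H r - H (r - eta) / 2 - H (r + eta) / 2.

Section ModulatedKernel.
Context {R : realType} (p q w H : R -> R) (K : kernel p q w H) (eta : R).

Local Notation m := (modulation eta).

Lemma modulation_ge0 s : 0 <= m s.
Proof. by rewrite subr_ge0 cos_le1. Qed.

Lemma modulation_le2 s : m s <= 2.
Proof. by rewrite /modulation; have := cos_geN1 (2 * pi * eta * s); lra. Qed.

(** This linear bound near 0 trades the factor 2 of [modulation_le2] for one more power of [|s|],
    hence a moment of one order higher. *)
Lemma modulation_le_norm s : m s <= 2 * pi * `|eta| * `|s|.
Proof.
have := cos_lipschitz 0 (2 * pi * eta * s).
rewrite cos0 sub0r normrN (ger0_norm (modulation_ge0 s)) => /le_trans -> //.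
by rewrite !normrM ger0_norm// ger0_norm ?pi_ge0.
Qed.

Let measurable_modulation : measurable_fun setT m.
Proof. by apply: measurable_funB => //; exact: measurable_cos_mul. Qed.

Let integ_modulated (f : R -> R) :
  (forall s, 0 <= f s) -> integ f -> integ (fun s => f s * m s).
Proof.
move=> f0 If; apply: (integ_le _ (fun s => 2 * f s)).
- by apply: measurable_funM => //; exact: integ_measurable.
- exact: integZ.
- move=> s; rewrite ger0_norm ?mulr_ge0 ?modulation_ge0// mulrC.
  by rewrite ler_wpM2r ?modulation_le2.
Qed.

(** The product-to-sum formulas in [cosE] and [sinE] express each transform of the modulated kernel
    through those of the original one at [r] and at [r + eta], [r - eta]; the modulation is
    nonnegative, so the modulus bound is simply multiplied by it. *)
Lemma modulated_kernel :
  kernel (fun s => p s * m s) (fun s => q s * m s) (fun s => w s * m s)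
    (modulated_hat H eta).
Proof.
have w0 := kernel_weight_ge0 _ _ _ _ K.
have mp := kernel_measurable_re _ _ _ _ K.
have mq := kernel_measurable_im _ _ _ _ K.
have pw := kernel_re_le _ _ _ _ K.
have qw := kernel_im_le _ _ _ _ K.
have ic (g : R -> R) c : measurable_fun setT g -> (forall s, `|g s| <= w s) ->
    integ (fun s => g s * cos (2 * pi * c * s)).
  move=> mg gw; apply: (kernel_integ_mul_bounded _ _ _ _ K g _ 1) => //.
  - exact: measurable_cos_mul.
  - by move=> s; exact: cos_max.
have isn (g : R -> R) c : measurable_fun setT g -> (forall s, `|g s| <= w s) ->
    integ (fun s => g s * sin (2 * pi * c * s)).
  move=> mg gw; apply: (kernel_integ_mul_bounded _ _ _ _ K g _ 1) => //.
  - exact: measurable_sin_mul.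
  - by move=> s; exact: sin_max.
have cosE (g : R -> R) r :
    measurable_fun setT g -> (forall s, `|g s| <= w s) ->
    Int (fun s => g s * m s * cos (2 * pi * r * s)) =
    Int (fun s => g s * cos (2 * pi * r * s)) -
    (2^-1 * Int (fun s => g s * cos (2 * pi * (r + eta) * s)) +
     2^-1 * Int (fun s => g s * cos (2 * pi * (r - eta) * s))).
  move=> mg gw; rewrite -!IntZ; [|exact: ic..].
  rewrite -IntD; [|by apply: integZ; exact: ic..].
  rewrite -IntB; [|exact: ic|by apply: integD; apply: integZ; exact: ic].
  apply: Int_eq => s; rewrite /modulation.
  have -> : 2 * pi * (r + eta) * s = 2 * pi * r * s + 2 * pi * eta * s by lra.
  have -> : 2 * pi * (r - eta) * s = 2 * pi * r * s - 2 * pi * eta * s by lra.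
  by rewrite cosD cosB; lra.
have sinE (g : R -> R) r :
    measurable_fun setT g -> (forall s, `|g s| <= w s) ->
    Int (fun s => g s * m s * sin (2 * pi * r * s)) =
    Int (fun s => g s * sin (2 * pi * r * s)) -
    (2^-1 * Int (fun s => g s * sin (2 * pi * (r + eta) * s)) +
     2^-1 * Int (fun s => g s * sin (2 * pi * (r - eta) * s))).
  move=> mg gw; rewrite -!IntZ; [|exact: isn..].
  rewrite -IntD; [|by apply: integZ; exact: isn..].
  rewrite -IntB; [|exact: isn|by apply: integD; apply: integZ; exact: isn].
  apply: Int_eq => s; rewrite /modulation.
  have -> : 2 * pi * (r + eta) * s = 2 * pi * r * s + 2 * pi * eta * s by lra.
  have -> : 2 * pi * (r - eta) * s = 2 * pi * r * s - 2 * pi * eta * s by lra.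
  by rewrite sinD sinB; lra.
split.
- exact: measurable_funM.
- exact: measurable_funM.
- move=> u v s uv.
  rewrite !mulrA -mulrDl normrM (ger0_norm (modulation_ge0 s)).
  by rewrite ler_wpM2r ?modulation_ge0// (kernel_bound _ _ _ _ K).
- exact: integ_modulated (kernel_integ0 _ _ _ _ K).
- have := integ_modulated _ _ (kernel_integ1 _ _ _ _ K).
  move=> /(_ (fun s => mulr_ge0 (normr_ge0 s) (w0 s))).
  by apply: integ_eq => s; rewrite mulrA.
- have := integ_modulated _ _ (kernel_integ2 _ _ _ _ K).
  move=> /(_ (fun s => mulr_ge0 (sqr_ge0 s) (w0 s))).
  by apply: integ_eq => s; rewrite mulrA.
- move=> r; rewrite cosE// !(kernel_re_cos _ _ _ _ K) /modulated_hat.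
  by rewrite !opprD opprK (addrC (- r) eta) (addrC (- r) (- eta)); lra.
- by move=> r; rewrite sinE// !(kernel_re_sin _ _ _ _ K); lra.
- by move=> r; rewrite cosE// !(kernel_im_cos _ _ _ _ K); lra.
- move=> r; rewrite sinE// !(kernel_im_sin _ _ _ _ K) /modulated_hat.
  by rewrite !opprD opprK (addrC (- r) eta) (addrC (- r) (- eta)); lra.
Qed.

Lemma modulated_moment_le2 (e : R -> R) :
  (forall s, 0 <= e s) -> integ (fun s => e s * w s) ->
  Int (fun s => e s * (w s * m s)) <= 2 * Int (fun s => e s * w s).
Proof.
move=> e0 Ie; have w0 := kernel_weight_ge0 _ _ _ _ K.
have ew0 s : 0 <= e s * w s by rewrite mulr_ge0.
rewrite -IntZ//; apply: le_Int.
- by have := integ_modulated _ ew0 Ie; apply: integ_eq => s; rewrite mulrA.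
- exact: integZ.
- by move=> s; rewrite mulrA mulrC ler_wpM2r ?modulation_le2.
Qed.

Lemma modulated_moment_le (e : R -> R) :
  (forall s, 0 <= e s) -> integ (fun s => e s * w s) ->
  integ (fun s => (e s * `|s|) * w s) ->
  Int (fun s => e s * (w s * m s)) <=
  2 * pi * `|eta| * Int (fun s => (e s * `|s|) * w s).
Proof.
move=> e0 Ie Ies; have w0 := kernel_weight_ge0 _ _ _ _ K.
have ew0 s : 0 <= e s * w s by rewrite mulr_ge0.
rewrite -IntZ//; apply: le_Int.
- by have := integ_modulated _ ew0 Ie; apply: integ_eq => s; rewrite mulrA.
- exact: integZ.
- move=> s.
  have -> : 2 * pi * `|eta| * (e s * `|s| * w s) =
    (e s * w s) * (2 * pi * `|eta| * `|s|) by lra.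
  by rewrite mulrA ler_wpM2l ?modulation_le_norm.
Qed.

End ModulatedKernel.

(** * The wavelet: its transform, its kernel structure and its moments *)

Section Wavelet.
Context {R : realType} (d : R) (hd0 : 0 < d) (hd1 : d < 1).

Lemma Delta_gt0 : 0 < Delta d.
Proof. by have ? := hd0; rewrite /Delta divr_gt0// mulr_gt0//; lra. Qed.

Lemma Delta_lt : 4 * Delta d < 1.
Proof.
by have ? := hd0; have ? := hd1; rewrite /Delta mulrA ltr_pdivrMr; lra.
Qed.

(** Turns the separation condition, which bounds the ratio of consecutive frequencies by
    [(1 - d) / (1 + d)], into the gap [1 - 4 * Delta d]. *)
Lemma Delta_ratio : 1 - d = (1 + d) * (1 - 4 * Delta d).
Proof. by have ? := hd0; rewrite /Delta; field; rewrite gt_eqF//; lra. Qed.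

Lemma psi_hat_ge0 xi : 0 <= psi_hat d xi.
Proof. by rewrite /psi_hat; case: ifP => // _; rewrite mulr_ge0 ?expR_ge0. Qed.

(** With [u = ((1 - xi) / Delta d)^2] in [0, 1), the exponent [1 / (u - 1)] is at most -1 and
    compensates the factor e. *)
Lemma psi_hat_le1 xi : psi_hat d xi <= 1.
Proof.
rewrite /psi_hat; case: ifP => // /andP[h1 h2].
have D0 := Delta_gt0.
have : ((1 - xi) / Delta d) ^+ 2 < 1.
  rewrite -real_normK ?num_real// expr_lt1// normrM normfV (gtr0_norm D0).
  by rewrite ltr_pdivrMr// mul1r ltr_norml; apply/andP; split; lra.
set u := (_ ^+ 2) => u1.
have u0 : 0 <= u by exact: sqr_ge0.
rewrite -expRD -[leRHS]expR0 ler_expR -lerBrDl sub0r.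
by rewrite ler_ndivrMr; lra.
Qed.

Lemma psi_hat_eq0 xi : Delta d <= `|xi - 1| -> psi_hat d xi = 0.
Proof.
move=> h; rewrite /psi_hat; case: ifP => // /andP[h1 h2].
suff : `|xi - 1| < Delta d by rewrite ltNge h.
by rewrite ltr_norml; apply/andP; split; lra.
Qed.

Lemma psi_hat1 : psi_hat d 1 = 1.
Proof.
have D0 := Delta_gt0.
rewrite /psi_hat ifT; last by apply/andP; split; lra.
by rewrite subrr mul0r expr0n/= sub0r invrN invr1 mulrN1 -expRD subrr expR0.
Qed.

Variables (psi : R -> R[i]) (hpsi : is_wavelet d psi).

Let p t := complex.Re (psi t).
Let q t := complex.Im (psi t).
Let w t := Normc.normc (psi t).

Let normcE t : w t = Num.sqrt (p t ^+ 2 + q t ^+ 2).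
Proof. by rewrite /w /p /q; case: (psi t). Qed.

Let w_ge0 t : 0 <= w t.
Proof. by rewrite normcE sqrtr_ge0. Qed.

(** Cauchy-Schwarz in the plane, by Lagrange's identity. *)
Let bound u v s : u ^+ 2 + v ^+ 2 = 1 -> `|u * p s + v * q s| <= w s.
Proof.
move=> uv; rewrite normcE -sqrtr_sqr ler_sqrt ?addr_ge0 ?sqr_ge0//.
rewrite -[leRHS]mul1r -uv -subr_ge0.
have -> : (u ^+ 2 + v ^+ 2) * (p s ^+ 2 + q s ^+ 2) - (u * p s + v * q s) ^+ 2
  = (u * q s - v * p s) ^+ 2 by ring.
exact: sqr_ge0.
Qed.

Let measurable_re : measurable_fun setT p.
Proof.
have [[[+ _] _] _] := hpsi => dp.
by apply: measurable_of_derivable => t; exact: (dp 0%N).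
Qed.

Let measurable_im : measurable_fun setT q.
Proof.
have [[_ [+ _]] _] := hpsi => dp.
by apply: measurable_of_derivable => t; exact: (dp 0%N).
Qed.

Lemma wavelet_moment_integ i : integ (fun s => `|s| ^+ i * w s).
Proof.
have [[sp sq] _] := hpsi.
apply: (integ_le _ (fun s => `|s| ^+ i * `|p s| + `|s| ^+ i * `|q s|)).
- apply: measurable_funM.
    by apply: measurable_funX; exact: normr_measurable.
  apply: (eq_measurable_fun (fun t => Num.sqrt (p t ^+ 2 + q t ^+ 2))).
    by move=> t _; rewrite normcE.
  apply: (@measurableT_comp _ _ _ _ _ _ (@Num.sqrt R)).
    by apply: continuous_measurable_fun; exact: sqrt_continuous.
  by apply: measurable_funD; exact: measurable_funX.
- by apply: integD; exact: schwartz_moment.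
- move=> s; rewrite ger0_norm ?mulr_ge0 ?exprn_ge0// -mulrDr.
  rewrite ler_wpM2l ?exprn_ge0// normcE -(@ler_pXn2r _ 2) ?nnegrE ?sqrtr_ge0 ?addr_ge0//.
  rewrite sqr_sqrtr ?addr_ge0 ?sqr_ge0// sqrrD !real_normK ?num_real//.
  have : 0 <= `|p s| * `|q s| by rewrite mulr_ge0.
  lra.
Qed.

(** Cosine integrals are even in [r] and sine integrals are odd. Adding and subtracting the real and
    imaginary parts of the Fourier identity at [r] and at [-r] therefore isolates each of the four
    integrals. *)
Lemma wavelet_kernel : kernel p q w (psi_hat d).
Proof.
have I0 : integ w.
  by apply: integ_eq (wavelet_moment_integ 0) => s; rewrite expr0 mul1r.
have pw s : `|p s| <= w s.
  have := bound 1 0 s; rewrite mul1r mul0r addr0; apply.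
  by rewrite expr1n expr0n addr0.
have qw s : `|q s| <= w s.
  have := bound 0 1 s; rewrite mul1r mul0r add0r; apply.
  by rewrite expr1n expr0n add0r.
have ib (g h : R -> R) : measurable_fun setT g -> (forall s, `|g s| <= w s) ->
    measurable_fun setT h -> (forall s, `|h s| <= 1) ->
    integ (fun s => g s * h s).
  move=> mg gw mh h1; apply: integ_le I0 _; first exact: measurable_funM.
  by move=> s; rewrite normrM -[leRHS]mulr1 ler_pM.
have Ipc r : integ (fun s => p s * cos (2 * pi * r * s)).
  by apply: ib => // [|s]; [exact: measurable_cos_mul|exact: cos_max].
have Ips r : integ (fun s => p s * sin (2 * pi * r * s)).
  by apply: ib => // [|s]; [exact: measurable_sin_mul|exact: sin_max].
have Iqc r : integ (fun s => q s * cos (2 * pi * r * s)).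
  by apply: ib => // [|s]; [exact: measurable_cos_mul|exact: cos_max].
have Iqs r : integ (fun s => q s * sin (2 * pi * r * s)).
  by apply: ib => // [|s]; [exact: measurable_sin_mul|exact: sin_max].
have FE r : Int (fun s => p s * cos (2 * pi * r * s)) +
    Int (fun s => q s * sin (2 * pi * r * s)) = psi_hat d r /\
    Int (fun s => q s * cos (2 * pi * r * s)) -
    Int (fun s => p s * sin (2 * pi * r * s)) = 0.
  have := hpsi.2 r; rewrite /fourier /integralC => -[Er Ei].
  rewrite -IntD// -IntB//; split; [rewrite -Er|rewrite -Ei]; apply: Int_eq => s;
    rewrite /p /q /expi sinN cosN; case: (psi s) => a b /=; lra.
have even (g : R -> R) r : Int (fun s => g s * cos (2 * pi * - r * s)) =
    Int (fun s => g s * cos (2 * pi * r * s)).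
  by apply: Int_eq => s; rewrite mulrN mulNr cosN.
have odd (g : R -> R) r : integ (fun s => g s * sin (2 * pi * r * s)) ->
    Int (fun s => g s * sin (2 * pi * - r * s)) =
    - Int (fun s => g s * sin (2 * pi * r * s)).
  move=> Ig; rewrite -[RHS]mulN1r -IntZ//.
  by apply: Int_eq => s; rewrite mulrN mulNr sinN mulN1r mulrN.
split => //.
- by apply: integ_eq (wavelet_moment_integ 1) => s; rewrite expr1.
- apply: integ_eq (wavelet_moment_integ 2) => s.
  by rewrite real_normK ?num_real.
- by move=> r; have [] := FE r; have [] := FE (- r);
    rewrite !even !odd//; lra.
- by move=> r; have [] := FE r; have [] := FE (- r);
    rewrite !even !odd//; lra.
- by move=> r; have [] := FE r; have [] := FE (- r);
    rewrite !even !odd//; lra.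
- by move=> r; have [] := FE r; have [] := FE (- r);
    rewrite !even !odd//; lra.
Qed.

Lemma I_E i : I_ psi i = Int (fun s => `|s| ^+ i * w s).
Proof. by []. Qed.

Lemma absmoment_fin_num i : absmoment psi i \is a fin_num.
Proof.
by have := integrable_fin_num measurableT (wavelet_moment_integ i).
Qed.

Lemma I_ge0 i : 0 <= I_ psi i.
Proof. by rewrite I_E; apply: Int_ge0 => s; rewrite mulr_ge0 ?exprn_ge0. Qed.

(* [psi_hat d] drops from 1 to 0 between 1 and [1 + Delta d]. *)
Lemma I1_ge : 1 / 4 <= I_ psi 1.
Proof.
have K := wavelet_kernel; have D0 := Delta_gt0; have D1 := Delta_lt.
have FE r : Int (fun s => p s * cos (2 * pi * r * s)) +
    Int (fun s => q s * sin (2 * pi * r * s)) = psi_hat d r.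
  by rewrite (kernel_re_cos _ _ _ _ K) (kernel_im_sin _ _ _ _ K); lra.
have := FE 1; rewrite psi_hat1.
have := FE (1 + Delta d).
rewrite psi_hat_eq0; last by rewrite addrAC subrr add0r ger0_norm// ltW.
have Ic r : integ (fun s => p s * cos (2 * pi * r * s)).
  apply: (kernel_integ_mul_bounded _ _ _ _ K p _ 1) => //.
  - exact: kernel_re_le K.
  - exact: measurable_cos_mul.
  - by move=> s; exact: cos_max.
have Is r : integ (fun s => q s * sin (2 * pi * r * s)).
  apply: (kernel_integ_mul_bounded _ _ _ _ K q _ 1) => //.
  - exact: kernel_im_le K.
  - exact: measurable_sin_mul.
  - by move=> s; exact: sin_max.
rewrite -!IntD// => E2 E1.
have : Int (fun s => (p s * cos (2 * pi * 1 * s) + q s * sin (2 * pi * 1 * s)) -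
  (p s * cos (2 * pi * (1 + Delta d) * s) +
   q s * sin (2 * pi * (1 + Delta d) * s))) = 1.
  by rewrite IntB ?E1 ?E2 ?subr0//; exact: integD.
move=> E.
have := norm_Int_le (fun s => (p s * cos (2 * pi * 1 * s) + q s * sin (2 * pi * 1 * s)) -
  (p s * cos (2 * pi * (1 + Delta d) * s) +
   q s * sin (2 * pi * (1 + Delta d) * s))) (fun s => 4 * (`|s| ^+ 1 * w s)).
rewrite E normr1 IntZ ?I_E; last exact: wavelet_moment_integ.
move=> /(_ ltac:(by apply: integB; exact: integD)).
move=> /(_ ltac:(by apply: integZ; exact: wavelet_moment_integ)).
suff H s : `|p s * cos (2 * pi * 1 * s) + q s * sin (2 * pi * 1 * s) -
    (p s * cos (2 * pi * (1 + Delta d) * s) +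
     q s * sin (2 * pi * (1 + Delta d) * s))| <= 4 * (`|s| ^+ 1 * w s).
  by move=> /(_ H); lra.
set x := 2 * pi * 1 * s; set y := 2 * pi * (1 + Delta d) * s.
have -> : p s * cos x + q s * sin x - (p s * cos y + q s * sin y) =
  p s * (cos x - cos y) + q s * (sin x - sin y) by ring.
(* The two phases differ by [2 * pi * Delta d * s], at most [2 * |s|] in modulus because
   [4 * Delta d < 1]. The cosine and sine terms contribute one such factor each, which gives the
   4. *)
have pi4 : pi < 4 :> R by have := @pihalf_lt2 R; lra.
have xy : `|x - y| <= 2 * `|s|.
  have -> : x - y = - (2 * pi * Delta d * s) by rewrite /x /y; ring.
  have pi0 := @pi_gt0 R.
  rewrite normrN normrM ler_wpM2r// ger0_norm; last first.
    by apply: mulr_ge0; [apply: mulr_ge0|]; lra.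
  have : pi * (4 * Delta d) <= 4 * 1 by apply: ler_pM; lra.
  lra.
rewrite (le_trans (ler_normD _ _))// !normrM.
have h1 : `|p s| * `|cos x - cos y| <= w s * (2 * `|s|).
  by apply: ler_pM => //; [exact: kernel_re_le K _|
    exact: le_trans (cos_lipschitz _ _) xy].
have h2 : `|q s| * `|sin x - sin y| <= w s * (2 * `|s|).
  by apply: ler_pM => //; [exact: kernel_im_le K _|
    exact: le_trans (sin_lipschitz _ _) xy].
rewrite expr1; lra.
Qed.

End Wavelet.

(** * Approximation of the transform *)

Section ComponentBounds.
Context {R : realType} {c1 c2 eps : R} {A phi : R -> R}.
Hypothesis hA : in_A_eps c1 c2 eps A phi.
Hypothesis heps : 0 < eps.

Lemma einf_lt_pointwise (g : R -> R) : (c1%:E < einf g)%E -> forall t, c1 < g t.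
Proof.
move=> h t; rewrite -lte_fin; apply: (lt_le_trans h).
by apply: ereal_inf_lbound; exists t.
Qed.

Lemma esup_gt_pointwise (g : R -> R) : (esup g < c2%:E)%E -> forall t, g t < c2.
Proof.
move=> h t; rewrite -lte_fin; apply: le_lt_trans h.
by apply: ereal_sup_ubound; exists t.
Qed.

Lemma amplitude_bounds t : c1 < A t < c2.
Proof.
have [_ [_ _ h1 h2] _ _ _] := hA.
by rewrite einf_lt_pointwise ?esup_gt_pointwise.
Qed.

Lemma frequency_bounds t : c1 < derive1 phi t < c2.
Proof.
have [_ _ [_ h1 h2] _ _] := hA.
by rewrite einf_lt_pointwise ?esup_gt_pointwise.
Qed.

Lemma amplitude_derivable t : derivable A t 1.
Proof. by have [_ [[h _] _ _ _] _ _ _] := hA; exact: (h 0%N). Qed.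

Lemma phase_derivable t : derivable phi t 1.
Proof. by have [_ _ [[h _] _ _] _ _] := hA; exact: (h 0%N). Qed.

Lemma frequency_derivable t : derivable (derive1 phi) t 1.
Proof. by have [_ _ [[h _] _ _] _ _] := hA; exact: (h 1%N). Qed.

Let eps_frequency t : eps * derive1 phi t <= eps * c2.
Proof.
have /andP[_ ?] := frequency_bounds t.
by rewrite ler_wpM2l// ltW.
Qed.

Lemma amplitude_lipschitz x y : `|A x - A y| <= eps * c2 * `|x - y|.
Proof.
apply: lipschitz_of_derive => t.
  exact: derivable_is_derive1 amplitude_derivable t.
have [_ _ _ h _] := hA.
exact: le_trans (h t) (eps_frequency t).
Qed.

Lemma frequency_lipschitz x y :
  `|derive1 phi x - derive1 phi y| <= eps * c2 * `|x - y|.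
Proof.
apply: lipschitz_of_derive => t.
  exact: derivable_is_derive1 frequency_derivable t.
have [_ _ _ _ h] := hA.
exact: le_trans (h t) (eps_frequency t).
Qed.

Lemma phase_taylor b h :
  `|phi (b + h) - phi b - derive1 phi b * h| <= eps * c2 * h ^+ 2 / 2.
Proof.
apply: second_order_taylor; last exact: frequency_lipschitz.
exact: derivable_is_derive1 phase_derivable.
Qed.

Lemma component_continuous : continuous (imf A phi).
Proof.
have [[[h _] _] _ _ _ _] := hA.
by apply: continuous_of_derivable => t; exact: (h 0%N).
Qed.

(** The first error term comes from the change of amplitude. The second comes from the change of
    phase: [2 * pi] times the Taylor remainder [eps * c2 * h^2 / 2], times the amplitude bound
    [c2]. *)
Lemma component_linearization (b h : R) : 0 < c1 ->
  `|imf A phi (b + h) - A b * cos (2 * pi * (phi b + derive1 phi b * h))| <=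
  eps * c2 * `|h| + pi * eps * c2 ^+ 2 * h ^+ 2.
Proof.
move=> hc1; have /andP[a1 a2] := amplitude_bounds b.
have pi0 := @pi_gt0 R.
rewrite /imf.
set X := cos _; set Y := cos _.
have -> : A (b + h) * X - A b * Y = (A (b + h) - A b) * X + A b * (X - Y) by ring.
rewrite (le_trans (ler_normD _ _))// lerD//.
  rewrite normrM -[leRHS]mulr1 ler_pM ?cos_max//.
  have := amplitude_lipschitz (b + h) b.
  by rewrite (addrC b) addrK.
rewrite normrM (ger0_norm (ltW (lt_trans hc1 a1))).
have XY : `|X - Y| <= 2 * pi * (eps * c2 * h ^+ 2 / 2).
  rewrite (le_trans (cos_lipschitz _ _))//.
  have pi20 : 0 <= 2 * pi :> R by lra.
  rewrite -mulrBr normrM (ger0_norm pi20).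
  by rewrite ler_wpM2l// opprD addrA phase_taylor.
have : A b * `|X - Y| <= c2 * (2 * pi * (eps * c2 * h ^+ 2 / 2)).
  by apply: ler_pM => //; lra.
move=> /le_trans; apply; lra.
Qed.

End ComponentBounds.

Section Approximation.
Context {R : realType} (p q w H : R -> R).
Variables (c1 c2 eps : R).
Variable K : kernel p q w H.
Hypothesis hH : forall r, r < 0 -> H r = 0.
Hypothesis hc1 : 0 < c1.
Hypothesis heps : 0 < eps.

(** The bound of [component_linearization] at [h = s / x], with [1 / x] replaced by [1 / c1],
    integrated against a weight whose absolute moments of orders 1 and 2 are [J1] and [J2]. *)
Definition approx_error (J1 J2 : R) : R :=
  eps * (c2 / c1) * (J1 + pi * (c2 / c1) * J2).

Variables (u v b x : R).
Hypothesis uv : u ^+ 2 + v ^+ 2 = 1.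
Hypothesis hx : c1 < x.

Let h (s : R) : R := u * p s + v * q s.

Let measurable_h : measurable_fun setT h.
Proof.
apply: measurable_funD; apply: measurable_funM => //.
- exact: kernel_measurable_re K.
- exact: kernel_measurable_im K.
Qed.

Let h_le s : `|h s| <= w s.
Proof. exact: kernel_bound K _ _ _ uv. Qed.

Let scale (s : R) : R := b + s / x.

Let continuous_scale : continuous scale.
Proof.
apply: continuous_of_derivable => t; rewrite /scale; apply: ex_derive.
Qed.

Lemma component_integ A phi : in_A_eps c1 c2 eps A phi ->
  integ (fun s => imf A phi (scale s) * h s).
Proof.
move=> hA.
apply: (integ_eq (fun s => h s * imf A phi (scale s))).
  by move=> s; rewrite mulrC.
apply: (kernel_integ_mul_bounded _ _ _ _ K h _ c2) => //.
  apply: continuous_measurable_fun => t.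
  apply: continuous_comp; first exact: continuous_scale.
  exact: (component_continuous hA).
move=> s; have /andP[a1 a2] := amplitude_bounds hA (scale s).
rewrite /imf normrM -[leRHS]mulr1 ler_pM ?cos_max// gtr0_norm ?ltW//.
exact: lt_trans hc1 a1.
Qed.

Lemma component_transform_approx A phi : in_A_eps c1 c2 eps A phi ->
  `|Int (fun s => imf A phi (scale s) * h s) -
    A b * (u * cos (2 * pi * phi b) - v * sin (2 * pi * phi b)) *
      H (derive1 phi b / x) / 2| <=
  approx_error (Int (fun s => `|s| * w s)) (Int (fun s => s ^+ 2 * w s)).
Proof.
move=> hA.
have ? := hc1; have ? := hx; have ? := heps.
have x0 : 0 < x by lra.
have /andP[y1 y2] := frequency_bounds hA b.
have /andP[a1 a2] := amplitude_bounds hA b.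
set r := derive1 phi b / x.
have r0 : 0 < r by rewrite divr_gt0//; lra.
set c := cos (2 * pi * phi b); set sn := sin (2 * pi * phi b).
have w0 := kernel_weight_ge0 _ _ _ _ K.
pose M s := A b * cos (2 * pi * (phi b + derive1 phi b * (s / x))).
have ME s : M s * h s = A b * (c * u * (p s * cos (2 * pi * r * s)) +
     c * v * (q s * cos (2 * pi * r * s)) -
     (sn * u * (p s * sin (2 * pi * r * s)) +
      sn * v * (q s * sin (2 * pi * r * s)))).
  rewrite /M /h.
  have -> : 2 * pi * (phi b + derive1 phi b * (s / x)) =
    2 * pi * phi b + 2 * pi * r * s by rewrite /r; ring.
  rewrite cosD -/c -/sn; ring.
have Ic (g : R -> R) : measurable_fun setT g -> (forall s, `|g s| <= w s) ->
    integ (fun s => g s * cos (2 * pi * r * s)).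
  move=> mg gw; apply: (kernel_integ_mul_bounded _ _ _ _ K g _ 1) => //.
  - exact: measurable_cos_mul.
  - by move=> s; exact: cos_max.
have Is (g : R -> R) : measurable_fun setT g -> (forall s, `|g s| <= w s) ->
    integ (fun s => g s * sin (2 * pi * r * s)).
  move=> mg gw; apply: (kernel_integ_mul_bounded _ _ _ _ K g _ 1) => //.
  - exact: measurable_sin_mul.
  - by move=> s; exact: sin_max.
have mp := kernel_measurable_re _ _ _ _ K.
have mq := kernel_measurable_im _ _ _ _ K.
have pw := kernel_re_le _ _ _ _ K.
have qw := kernel_im_le _ _ _ _ K.
have I1 := Ic _ mp pw; have I2 := Ic _ mq qw.
have I3 := Is _ mp pw; have I4 := Is _ mq qw.
have I12 := integD _ _ (integZ (c * u) _ I1) (integZ (c * v) _ I2).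
have I34 := integD _ _ (integZ (sn * u) _ I3) (integZ (sn * v) _ I4).
have IM : integ (fun s => M s * h s).
  by apply: integ_eq (integZ (A b) _ (integB _ _ I12 I34)) => s; rewrite ME.
have -> : A b * (u * c - v * sn) * H r / 2 = Int (fun s => M s * h s).
  rewrite (Int_eq _ _ ME) IntZ; last exact: integB I12 I34.
  rewrite IntB// IntD; [|exact: integZ..]. rewrite IntD; [|exact: integZ..].
  rewrite !IntZ// (kernel_re_cos _ _ _ _ K) (kernel_re_sin _ _ _ _ K).
  rewrite (kernel_im_cos _ _ _ _ K) (kernel_im_sin _ _ _ _ K).
  by rewrite (hH (- r)) ?oppr_lt0//; lra.
have If := component_integ _ _ hA.
rewrite -IntB//.
have J1 := kernel_integ1 _ _ _ _ K; have J2 := kernel_integ2 _ _ _ _ K.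
rewrite /approx_error.
have -> : eps * (c2 / c1) *
    (Int (fun s => `|s| * w s) + pi * (c2 / c1) * Int (fun s => s ^+ 2 * w s)) =
    Int (fun s => eps * (c2 / c1) * (`|s| * w s) +
      eps * (c2 / c1) * (pi * (c2 / c1)) * (s ^+ 2 * w s)).
  by rewrite IntD; [rewrite !IntZ//; ring|exact: integZ..].
apply: norm_Int_le => [||s].
- exact: integB.
- by apply: integD; exact: integZ.
rewrite -mulrBl normrM.
have L := component_linearization hA heps b (s / x) hc1.
have L2 : `|imf A phi (scale s) - M s| <=
    eps * (c2 / c1) * `|s| + eps * (c2 / c1) * (pi * (c2 / c1)) * s ^+ 2.
  apply: (le_trans L).
  have pi0 := @pi_gt0 R.
  have xc : x^-1 <= c1^-1 by rewrite lef_pV2 ?posrE// ltW.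
  have xv0 : 0 <= x^-1 by rewrite invr_ge0 ltW.
  have c20 : 0 < c2 by lra.
  apply: lerD.
    rewrite normrM (ger0_norm xv0).
    have -> : eps * c2 * (`|s| * x^-1) = eps * c2 * `|s| * x^-1 by ring.
    have -> : eps * (c2 / c1) * `|s| = eps * c2 * `|s| * c1^-1 by ring.
    by rewrite ler_wpM2l// !mulr_ge0// ltW.
  rewrite exprMn.
  have -> : pi * eps * c2 ^+ 2 * (s ^+ 2 * x^-1 ^+ 2) =
    pi * eps * c2 ^+ 2 * s ^+ 2 * x^-1 ^+ 2 by ring.
  have -> : eps * (c2 / c1) * (pi * (c2 / c1)) * s ^+ 2 =
    pi * eps * c2 ^+ 2 * s ^+ 2 * c1^-1 ^+ 2 by ring.
  have cst : 0 <= pi * eps * c2 ^+ 2 * s ^+ 2.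
    by rewrite mulr_ge0 ?sqr_ge0// mulr_ge0 ?sqr_ge0// mulr_ge0// ltW.
  rewrite ler_wpM2l//.
  by rewrite ler_pXn2r ?nnegrE// invr_ge0 ltW.
have := ler_pM (normr_ge0 _) (normr_ge0 _) L2 (h_le s).
by move=> /le_trans; apply; lra.
Qed.

Lemma transform_approx n (A phi : 'I_n -> R -> R) (f : R -> R) :
  (forall k, in_A_eps c1 c2 eps (A k) (phi k)) ->
  (forall t, f t = \sum_(k < n) imf (A k) (phi k) t) ->
  `|Int (fun s => f (scale s) * h s) -
    \sum_(k < n) A k b * (u * cos (2 * pi * phi k b) - v * sin (2 * pi * phi k b)) *
      H (derive1 (phi k) b / x) / 2| <=
  n%:R * approx_error (Int (fun s => `|s| * w s)) (Int (fun s => s ^+ 2 * w s)).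
Proof.
move=> hA fE.
have -> : Int (fun s => f (scale s) * h s) =
    \sum_(k < n) Int (fun s => imf (A k) (phi k) (scale s) * h s).
  rewrite -Int_sum; last by move=> k; exact: component_integ.
  by apply: Int_eq => s; rewrite fE mulr_suml.
rewrite -sumrB (le_trans (ler_norm_sum _ _ _))//.
rewrite (le_trans (ler_sum _ (fun k _ => component_transform_approx _ _ (hA k))))//.
by rewrite sumr_const card_ord mulr_natl.
Qed.

End Approximation.

(** * Matching of separated frequencies *)

Section Separated.
Context {R : realType}.

Definition gapped (D : R) n (x : 'I_n -> R) : Prop :=
  forall i j : 'I_n, (i < j)%N -> x i <= (1 - 4 * D) * x j.

(** By [Delta_ratio] the adjacent condition is exactly the gap for neighbours; it passes to distant
    indices because the frequencies increase. *)
Lemma gapped_of_adjacent (d : R) n (x : 'I_n -> R) : 0 < d -> d < 1 ->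
  (forall i, 0 < x i) ->
  (forall i j : 'I_n, j = i.+1 :> nat -> d * (x j + x i) <= x j - x i) ->
  gapped (Delta d) n x.
Proof.
move=> d0 d1 x0 adj.
have D0 := Delta_gt0 _ d0; have D1 := Delta_lt _ d0 d1.
have Dr := Delta_ratio _ d0.
have adj' (i j : 'I_n) : j = i.+1 :> nat -> x i <= (1 - 4 * Delta d) * x j.
  move=> /adj h.
  have d10 : 0 < 1 + d by lra.
  rewrite -(ler_pM2l d10) mulrA -Dr; lra.
suff key (k : nat) : forall i j : 'I_n, j = (i + k).+1 :> nat ->
    x i <= (1 - 4 * Delta d) * x j.
  move=> i j ij; apply: (key (j - i.+1)%N).
  by rewrite -addSn subnKC.
elim: k => [|k IH] i j; first by rewrite addn0; exact: adj'.
move=> jE.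
have lt : ((i + k).+1 < n)%N by rewrite (leq_trans _ (ltn_ord j))// jE addnS ltnW.
have h1 := IH i (Ordinal lt) erefl.
have h2 : x (Ordinal lt) <= (1 - 4 * Delta d) * x j by apply: adj'; rewrite /= jE addnS.
have xj := x0 j.
have h3 : (1 - 4 * Delta d) * x j <= x j by rewrite ler_piMl ?ltW//; lra.
have h4 : x (Ordinal lt) <= x j by lra.
by apply: (le_trans h1); rewrite ler_wpM2l//; lra.
Qed.

(** Logarithms of consecutive frequencies differ by at least [ln (1 + d) - ln (1 - d)] and all lie
    strictly between [ln c1] and [ln c2]. *)
Lemma card_adjacent (c1 c2 d : R) n (x : 'I_n -> R) :
  0 < d -> d < 1 -> 0 < c1 -> (0 < n)%N ->
  (forall i, c1 < x i < c2) ->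
  (forall i j : 'I_n, j = i.+1 :> nat -> d * (x j + x i) <= x j - x i) ->
  n%:R <= (Num.ceil ((ln c2 - ln c1) / (ln (1 + d) - ln (1 - d))))%:~R :> R.
Proof.
move=> d0 d1 c10; case: n x => // n x _ xb adj.
have d10 : 0 < 1 + d by lra.
have d20 : 0 < 1 - d by lra.
have lnx k (hk : (k < n.+1)%N) :
    ln c1 + k%:R * (ln (1 + d) - ln (1 - d)) < ln (x (Ordinal hk)).
  elim: k hk => [|k IH] hk.
    rewrite mul0r addr0.
    have /andP[h1 _] := xb (Ordinal hk).
    by rewrite ltr_ln ?posrE// (lt_trans c10).
  have h := IH (ltnW hk).
  set i := Ordinal (ltnW hk) in h *; set j := Ordinal hk.
  have /andP[hi _] := xb i; have /andP[hj _] := xb j.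
  have step : x i * (1 + d) <= x j * (1 - d).
    by have := adj i j erefl; lra.
  have : ln (x i * (1 + d)) <= ln (x j * (1 - d)).
    by rewrite ler_ln// posrE mulr_gt0//; lra.
  rewrite !lnM ?posrE//; [|lra|lra].
  by rewrite -natr1 mulrDl mul1r; lra.
have := lnx n (ltnSn n); set j := Ordinal _ => h.
have /andP[hj1 hj2] := xb j.
have h2 : ln (x j) < ln c2 by rewrite ltr_ln ?posrE//; lra.
have lnpos : 0 < ln (1 + d) - ln (1 - d) by rewrite subr_gt0 ltr_ln ?posrE//; lra.
set X := (_ / _).
(* There are [n + 1] frequencies but only [n] gaps. The strict inequality recovers the missing unit:
   [n] is below the integer ceiling of [X], so [n + 1] is at most that ceiling. *)
have nX : n%:R < X by rewrite /X ltr_pdivlMr//; lra.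
have cX : n%:R < (Num.ceil X)%:~R :> R
  by apply: lt_le_trans nX _; exact: Num.Theory.ceil_ge.
have : (n%:Z < Num.ceil X)%R by rewrite -(ltr_int R).
by rewrite -lezD1 -(ler_int R) intrD -natr1.
Qed.

(** For [D = Delta d], outside this relation [psi_hat d (y / x)] vanishes. It is not symmetric in
    [x] and [y]. *)
Definition close_to (D x y : R) : bool := `|y / x - 1| < D.

Lemma close_toE (D x y : R) : 0 < x ->
  close_to D x y = ((1 - D) * x < y) && (y < (1 + D) * x).
Proof.
move=> x0; rewrite /close_to ltr_norml ltrBrDr ltrBlDr.
by rewrite ltr_pdivlMr// ltr_pdivrMr// (addrC _ 1) (addrC _ 1).
Qed.

Lemma increasing_ord_ge n m (g : 'I_n -> 'I_m) :
  (forall i j : 'I_n, (i < j)%N -> (g i < g j)%N) -> forall i : 'I_n, (i <= g i)%N.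
Proof.
move=> gi [k hk].
elim: k hk => [//|k IH] hk.
exact: leq_ltn_trans (IH (ltnW hk)) (gi (Ordinal (ltnW hk)) (Ordinal hk) (ltnSn k)).
Qed.

(** Since [(1 + D) * (1 - 4 * D) < 1 - D], the windows around [x i] and [x j] are disjoint and
    ordered, so [y (g i) < y (g j)]; the ordering of [y] then orders the indices. *)
Lemma close_increasing (D : R) n m (x : 'I_n -> R) (y : 'I_m -> R)
    (g : 'I_n -> 'I_m) : 0 < D -> 4 * D < 1 ->
  (forall i, 0 < x i) -> (forall i, 0 < y i) ->
  gapped D n x -> gapped D m y -> (forall i, close_to D (x i) (y (g i))) ->
  forall i j : 'I_n, (i < j)%N -> (g i < g j)%N.
Proof.
move=> D0 D1 x0 y0 gx gy xy i j ij.
have := xy i; have := xy j; rewrite !close_toE// => /andP[j1 j2] /andP[i1 i2].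
have := gx _ _ ij => h.
have xi := x0 i; have xj := x0 j.
have h1 : (1 + D) * x i <= (1 + D) * ((1 - 4 * D) * x j) by rewrite ler_wpM2l//; lra.
have h2 : 0 <= D * D * x j by rewrite !mulr_ge0// ltW.
have h3 : 0 < D * x j by rewrite mulr_gt0.
have lt : y (g i) < y (g j) by lra.
rewrite ltnNge leq_eqVlt; apply/negP => /orP[/eqP /val_inj E|/gy h4].
  by rewrite E ltxx in lt.
have h5 : (1 - 4 * D) * y (g i) <= y (g i) by rewrite ler_piMl ?ltW//; lra.
lra.
Qed.

(** Matchings [g] and [h] in the two directions are both increasing, which gives both inequalities
    between the cardinalities. The chain [i <= g i <= h (g i) <= i] shows that indices are
    preserved. *)
Lemma close_matching (D : R) n m (x : 'I_n -> R) (y : 'I_m -> R) :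
  0 < D -> 4 * D < 1 ->
  (forall i, 0 < x i) -> (forall i, 0 < y i) ->
  gapped D n x -> gapped D m y ->
  (forall i, exists j, close_to D (x i) (y j)) ->
  (forall j, exists i, close_to D (y j) (x i)) ->
  m = n /\ forall (i : 'I_n) (j : 'I_m), j = i :> nat -> close_to D (x i) (y j).
Proof.
move=> D0 D1 x0 y0 gx gy /fin_all_exists[g xg] /fin_all_exists[h yh].
have gi := close_increasing _ _ _ _ _ _ D0 D1 x0 y0 gx gy xg.
have hi := close_increasing _ _ _ _ _ _ D0 D1 y0 x0 gy gx yh.
have gge := increasing_ord_ge _ _ _ gi; have hge := increasing_ord_ge _ _ _ hi.
have le_card a b (k : 'I_a -> 'I_b) : (forall i : 'I_a, (i <= k i)%N) -> (a <= b)%N.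
  case: a k => // a k kk.
  exact: leq_ltn_trans (kk ord_max) (ltn_ord _).
split.
  by apply/eqP; rewrite eqn_leq (le_card _ _ _ gge) (le_card _ _ _ hge).
move=> i j ji.
suff -> : j = g i by [].
apply: val_inj => /=; rewrite ji.
have h1 := gge i; have h2 := hge (g i).
(* Going forth and back multiplies a frequency by less than [(1 + D)^2], whereas reaching a larger
   index requires a factor of at least [1 / (1 - 4 * D)], which is bigger. *)
have : ~~ (i < h (g i))%N.
  apply/negP => /gx h3.
  have := xg i; have := yh (g i); rewrite !close_toE// => /andP[_ a1] /andP[_ a2].
  have xi := x0 i.
  have b1 : (1 + D) * y (g i) <= (1 + D) * ((1 + D) * x i) by rewrite ler_wpM2l//; lra.
  have b2 : (1 - 4 * D) * x (h (g i)) <= (1 - 4 * D) * ((1 + D) * ((1 + D) * x i)).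
    by rewrite ler_wpM2l//; lra.
  have b3 : 0 <= D * D * x i by rewrite !mulr_ge0// ltW.
  have b4 : 0 < D * x i by rewrite mulr_gt0.
  have b5 : 0 <= D * D * D * x i by rewrite !mulr_ge0// ltW.
  lra.
rewrite -leqNgt => h3.
by apply/eqP; rewrite eqn_leq h1 (leq_trans h2 h3).
Qed.

End Separated.

(** Projecting the vectors of moduli [a], [A] and angles [al], [be] along [al] gives
    [a - A * h1 * cos (al - be) <= dl], and along [be] the same with roles exchanged; factors at
    most 1 then give the amplitude bound, and [dl < a] makes the cosine positive. The direction
    orthogonal to [be] removes the [A] term and leaves the sine. *)
Lemma amplitude_phase_of_projections {R : realType} (a A al be h1 h2 dl : R) :
  0 < A -> 0 <= h1 <= 1 -> 0 <= h2 <= 1 -> dl < a ->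
  (forall u v : R, u ^+ 2 + v ^+ 2 = 1 ->
     `|a * (u * cos al - v * sin al) - A * (u * cos be - v * sin be) * h1| <= dl) ->
  (forall u v : R, u ^+ 2 + v ^+ 2 = 1 ->
     `|A * (u * cos be - v * sin be) - a * (u * cos al - v * sin al) * h2| <= dl) ->
  [/\ `|a - A| <= dl, a * `|sin (al - be)| <= dl & 0 < cos (al - be)].
Proof.
move=> A0 /andP[h10 h11] /andP[h20 h21] dla B1 B2.
have dl0 : 0 <= dl
  by have := B1 1 0; rewrite expr1n expr0n addr0 => /(_ erefl); exact: le_trans.
have a0 : 0 < a by lra.
have ab1 : a - A * h1 * cos (al - be) <= dl.
  have := B1 (cos al) (- sin al); rewrite sqrrN cos2Dsin2 => /(_ erefl).
  rewrite ler_norml => /andP[_]; rewrite cosB.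
  have := cos2Dsin2 al; set c := cos al; set s := sin al => E.
  have -> : a * (c * c - - s * s) = a * (c ^+ 2 + s ^+ 2) by ring.
  rewrite E; lra.
have ab2 : A - a * h2 * cos (al - be) <= dl.
  have := B2 (cos be) (- sin be); rewrite sqrrN cos2Dsin2 => /(_ erefl).
  rewrite ler_norml => /andP[_]; rewrite cosB.
  have := cos2Dsin2 be; set c := cos be; set s := sin be => E.
  have -> : A * (c * c - - s * s) = A * (c ^+ 2 + s ^+ 2) by ring.
  rewrite E; lra.
have le1 (z h : R) : 0 < z -> 0 <= h -> h <= 1 -> z * h * cos (al - be) <= z.
  move=> z0 g0 g1; have zh0 : 0 <= z * h by rewrite mulr_ge0// ltW.
  have := ler_wpM2l zh0 (cos_le1 (al - be)).
  have : z * h <= z * 1 by rewrite ler_wpM2l// ltW.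
  lra.
have c0 : 0 < cos (al - be).
  rewrite ltNge; apply/negP => c0.
  have : A * h1 * cos (al - be) <= 0 by rewrite mulr_ge0_le0// mulr_ge0// ltW.
  lra.
split => //.
- have := le1 A h1 A0 h10 h11; have := le1 a h2 a0 h20 h21.
  by rewrite ler_norml => ? ?; apply/andP; split; lra.
- have := B1 (sin be) (cos be); rewrite addrC cos2Dsin2 => /(_ erefl).
  rewrite (mulrC (cos be) (sin be)) subrr mulr0 mul0r subr0 normrM (gtr0_norm a0).
  rewrite (_ : sin be * cos al - cos be * sin al = - sin (al - be)); last first.
    by rewrite sinB; ring.
  by rewrite normrN.
Qed.

(** * Comparison of two representations *)

(** For a larger frequency the ratio is at least [1 / (1 - 4 * D)], which exceeds [1 + 4 * D]. *)
Lemma gapped_far {R : realType} (D : R) n (x : 'I_n -> R) (k l : 'I_n) :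
  0 < D -> 4 * D < 1 -> (forall i, 0 < x i) -> gapped D n x -> k != l ->
  4 * D <= `|x k / x l - 1|.
Proof.
move=> D0 D1 x0 gx kl.
have xk := x0 k; have xl := x0 l.
have D20 : 0 <= D * D * x k by rewrite !mulr_ge0// ltW.
move: kl; rewrite neq_ltn => /orP[/gx h|/gx h].
  have : x k / x l <= 1 - 4 * D by rewrite ler_pdivrMr.
  by move=> ?; rewrite ler0_norm; lra.
have : 1 + 4 * D <= x k / x l.
  rewrite ler_pdivlMr//.
  have : (1 + 4 * D) * x l <= (1 + 4 * D) * ((1 - 4 * D) * x k)
    by rewrite ler_wpM2l//; lra.
  lra.
by move=> ?; rewrite ger0_norm; lra.
Qed.

(* The 4D gap between the frequencies survives replacing one of them by a
   frequency [z] that is close to it, up to a loss of D. *)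
Lemma gapped_far_close {R : realType} (D : R) n (x : 'I_n -> R) (k l : 'I_n) (z : R) :
  0 < D -> 4 * D < 1 -> (forall i, 0 < x i) -> gapped D n x -> k != l ->
  0 < z -> close_to D z (x l) -> 3 * D <= `|x k / z - 1|.
Proof.
move=> D0 D1 x0 gx kl z0; rewrite close_toE// => /andP[h1 h2].
have xk := x0 k; have xl := x0 l.
have D20 : 0 <= D * D * x k by rewrite !mulr_ge0// ltW.
have D2z : 0 <= D * D * z by rewrite !mulr_ge0// ltW.
move: kl; rewrite neq_ltn => /orP[/gx h|/gx h].
  have : x k / z <= 1 - 3 * D.
    rewrite ler_pdivrMr//.
    have : (1 - 4 * D) * x l <= (1 - 4 * D) * ((1 + D) * z)
      by rewrite ler_wpM2l ?ltW//; lra.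
    lra.
  by move=> ?; rewrite ler0_norm; lra.
(* After multiplication by [1 - 4 * D] this follows from [(1 - 4 * D) * (1 + 3 * D) <= 1 - D] and
   [(1 - D) * z < x l <= (1 - 4 * D) * x k]. *)
have : 1 + 3 * D <= x k / z.
  rewrite ler_pdivlMr//.
  rewrite -(@ler_pM2l _ (1 - 4 * D)); last by lra.
  have D3z : 0 <= D * D * D * z by rewrite !mulr_ge0// ltW.
  lra.
by move=> ?; rewrite ger0_norm; lra.
Qed.

Section Representation.
Context {R : realType} {c1 c2 eps d : R} {f : R -> R} {n : nat}
  {A phi : 'I_n -> R -> R}.
Hypothesis hrep : repr_in_A_eps_d c1 c2 eps d f A phi.

Lemma repr_component k : in_A_eps c1 c2 eps (A k) (phi k).
Proof. by have [_ _ h _] := hrep. Qed.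

Lemma repr_frequency_bounds k t : c1 < derive1 (phi k) t < c2.
Proof. exact: frequency_bounds (repr_component k) t. Qed.

Lemma repr_frequency_gt0 k t : 0 < c1 -> 0 < derive1 (phi k) t.
Proof. by move=> h; have /andP[+ _] := repr_frequency_bounds k t; exact: lt_trans. Qed.

Lemma repr_gapped t : 0 < d -> d < 1 -> 0 < c1 ->
  gapped (Delta d) n (fun k => derive1 (phi k) t).
Proof.
move=> d0 d1 c10; have [_ _ _ h] := hrep.
apply: gapped_of_adjacent => //.
- by move=> i; exact: repr_frequency_gt0.
- by move=> i j ij; have [] := h i j ij t.
Qed.

Lemma repr_card : 0 < d -> d < 1 -> 0 < c1 ->
  n%:R <= (Num.ceil ((ln c2 - ln c1) / (ln (1 + d) - ln (1 - d))))%:~R :> R.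
Proof.
move=> d0 d1 c10; have [n0 _ _ h] := hrep.
apply: (card_adjacent c1 c2 d n (fun k => derive1 (phi k) 0)) => //.
- by move=> i; exact: repr_frequency_bounds.
- by move=> i j ij; have [] := h i j ij 0.
Qed.

End Representation.

(** Both sums, halved, approximate the same integral of [f]; clearing the halves produces the factor
    2. *)
Lemma transform_difference {R : realType} (p q w H : R -> R) (c1 c2 eps d : R)
    (f : R -> R) (n m : nat) (a phi : 'I_n -> R -> R) (A vphi : 'I_m -> R -> R)
    (u v b x : R) :
  kernel p q w H -> (forall r : R, r < 0 -> H r = 0) -> 0 < c1 -> 0 < eps ->
  u ^+ 2 + v ^+ 2 = 1 -> c1 < x ->
  repr_in_A_eps_d c1 c2 eps d f a phi ->
  repr_in_A_eps_d c1 c2 eps d f A vphi ->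
  `|\sum_(k < n) a k b *
      (u * cos (2 * pi * phi k b) - v * sin (2 * pi * phi k b)) *
      H (derive1 (phi k) b / x) -
    \sum_(k < m) A k b *
      (u * cos (2 * pi * vphi k b) - v * sin (2 * pi * vphi k b)) *
      H (derive1 (vphi k) b / x)| <=
  2 * (n%:R + m%:R) * approx_error c1 c2 eps (Int (fun s => `|s| * w s))
    (Int (fun s => s ^+ 2 * w s)).
Proof.
move=> K hH c10 eps0 uv cx r1 r2.
have [_ f1 _ _] := r1; have [_ f2 _ _] := r2.
have := transform_approx _ _ _ _ _ _ _ K hH c10 eps0 _ _ b _ uv cx
  _ _ _ _ (repr_component r1) f1.
have := transform_approx _ _ _ _ _ _ _ K hH c10 eps0 _ _ b _ uv cx
  _ _ _ _ (repr_component r2) f2.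
rewrite -!mulr_suml.
set X := Int _; set S1 := \sum_(k < n) _; set S2 := \sum_(k < m) _.
set e := approx_error _ _ _ _ _.
rewrite !ler_norml => /andP[h1 h2] /andP[h3 h4]; apply/andP; split; lra.
Qed.

Lemma sum_eq_single {R : realType} n (F : 'I_n -> R) (l : 'I_n) :
  (forall k, k != l -> F k = 0) -> \sum_(k < n) F k = F l.
Proof. by move=> h; rewrite (bigD1 l)//= big1 ?addr0. Qed.

Lemma approx_error_le {R : realType} (c1 c2 eps J1 J2 J1' J2' : R) :
  0 < eps -> 0 < c1 -> c1 < c2 -> J1 <= J1' -> J2 <= J2' ->
  approx_error c1 c2 eps J1 J2 <= approx_error c1 c2 eps J1' J2'.
Proof.
move=> eps0 c10 c12 h1 h2; rewrite /approx_error.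
have rho0 : 0 <= c2 / c1 by rewrite divr_ge0//; lra.
have pi0 := @pi_ge0 R.
have erho0 : 0 <= eps * (c2 / c1) by rewrite mulr_ge0// ltW.
by rewrite ler_wpM2l// lerD// ler_wpM2l// mulr_ge0.
Qed.

Section Stages.
Context {R : realType} {c1 c2 eps d : R} {psi : R -> R[i]}.
Hypotheses (hd0 : 0 < d) (hd1 : d < 1) (hc1 : 0 < c1) (hc12 : c1 < c2).
Hypotheses (heps : 0 < eps) (hpsi : is_wavelet d psi).

Local Notation D := (Delta d).
Local Notation w := (fun t => Normc.normc (psi t)).

Let psi_hat_neg r : r < 0 -> psi_hat d r = 0.
Proof.
move=> r0; have := Delta_lt d hd0 hd1; have D0 := Delta_gt0 d hd0 => D1.
by apply: psi_hat_eq0; rewrite ler0_norm; lra.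
Qed.

Lemma moment1E : Int (fun s => `|s| * w s) = I_ psi 1.
Proof. by rewrite I_E; apply: Int_eq => s; rewrite expr1. Qed.

Lemma moment2E : Int (fun s => s ^+ 2 * w s) = I_ psi 2.
Proof. by rewrite I_E; apply: Int_eq => s; rewrite real_normK ?num_real. Qed.

(** Test at scale [x] equal to the frequency of component [l], in the direction of its phase. The
    gap reduces the first sum to [a l b > c1], and without a close frequency the second sum is 0, so
    the error would exceed [c1]. *)
Lemma exists_close_frequency (f : R -> R) (n m : nat) (a phi : 'I_n -> R -> R)
    (A vphi : 'I_m -> R -> R) (b : R) (l : 'I_n) :
  repr_in_A_eps_d c1 c2 eps d f a phi ->
  repr_in_A_eps_d c1 c2 eps d f A vphi ->
  2 * (n%:R + m%:R) * approx_error c1 c2 eps (I_ psi 1) (I_ psi 2) < c1 ->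
  exists k : 'I_m, close_to D (derive1 (phi l) b) (derive1 (vphi k) b).
Proof.
move=> r1 r2 small; apply: contrapT => /forallNP no.
have D0 := Delta_gt0 d hd0; have D1 := Delta_lt d hd0 hd1.
have /andP[x1 x2] := repr_frequency_bounds r1 l b.
have /andP[a1 a2] := amplitude_bounds (repr_component r1 l) b.
set x := derive1 (phi l) b in x1 x2 no.
have x0 : 0 < x by exact: lt_trans hc1 x1.
have := transform_difference _ _ _ _ _ _ _ _ _ _ _ _ _ _ _
  (cos (2 * pi * phi l b)) (- sin (2 * pi * phi l b)) b x
  (wavelet_kernel d psi hpsi) psi_hat_neg hc1 heps _ x1 r1 r2.
rewrite moment1E moment2E sqrrN cos2Dsin2 => /(_ erefl).
rewrite (sum_eq_single _ _ l); last first.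
  move=> k kl; rewrite psi_hat_eq0 ?mulr0//.
  have := gapped_far D n (fun k => derive1 (phi k) b) k l D0 D1
    (fun k => repr_frequency_gt0 r1 k b hc1) (repr_gapped r1 b hd0 hd1 hc1) kl.
  by have ? := D0 => h; apply: le_trans h; lra.
rewrite [X in _ - X]big1; last first.
  move=> k _; rewrite psi_hat_eq0 ?mulr0//.
  by have /negP := no k; rewrite /close_to -leNgt.
rewrite subr0 divff ?gt_eqF// (psi_hat1 d hd0) mulr1 mulNr opprK -!expr2.
rewrite cos2Dsin2 mulr1 gtr0_norm; last exact: lt_trans hc1 a1.
lra.
Qed.

(** This shift centres the three bumps of [Hm] at 1, [1 + 2 * D] and [1 - 2 * D], each of radius
    [D]: they do not overlap, and all stay within [3 * D] of 1. *)
Local Notation eta := (2 * D).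
Local Notation Hm := (modulated_hat (psi_hat d) eta).
Local Notation wm := (fun s => w s * modulation eta s).

Lemma modulated_hat_far r : 3 * D <= `|r - 1| -> Hm r = 0.
Proof.
have D0 := Delta_gt0 d hd0 => h.
rewrite /modulated_hat !psi_hat_eq0; first by rewrite !mul0r !subr0.
- have := ler_normD (r + eta - 1) (- eta).
  rewrite (_ : r + eta - 1 - eta = r - 1); last by ring.
  by rewrite normrN (@ger0_norm _ eta); lra.
- have := ler_normD (r - eta - 1) eta.
  rewrite (_ : r - eta - 1 + eta = r - 1); last by ring.
  by rewrite (@ger0_norm _ eta); lra.
- lra.
Qed.

Lemma modulated_hat_close r : `|r - 1| < D -> Hm r = psi_hat d r.
Proof.
have D0 := Delta_gt0 d hd0; rewrite ltr_norml => /andP[h1 h2].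
rewrite /modulated_hat (psi_hat_eq0 d (r - eta)); last by rewrite ler0_norm; lra.
rewrite (psi_hat_eq0 d (r + eta)); last by rewrite ger0_norm; lra.
by rewrite !mul0r !subr0.
Qed.

Let modulated_hat_neg r : r < 0 -> Hm r = 0.
Proof.
move=> r0; have D1 := Delta_lt d hd0 hd1; have D0 := Delta_gt0 d hd0.
by apply: modulated_hat_far; rewrite ler0_norm; lra.
Qed.

Definition modulated_error : R :=
  approx_error c1 c2 eps (Int (fun s => `|s| * wm s)) (Int (fun s => s ^+ 2 * wm s)).

Lemma modulated_error_le2 :
  modulated_error <= approx_error c1 c2 eps (2 * I_ psi 1) (2 * I_ psi 2).
Proof.
have K := wavelet_kernel d psi hpsi.
apply: approx_error_le => //.
- rewrite -moment1E; apply: (modulated_moment_le2 _ _ _ _ K) => //.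
  exact: kernel_integ1 K.
- rewrite -moment2E; apply: (modulated_moment_le2 _ _ _ _ K) => [s|].
    exact: sqr_ge0.
  exact: kernel_integ2 K.
Qed.

Lemma modulated_error_le_pi :
  modulated_error <= approx_error c1 c2 eps (pi * I_ psi 2) (pi * I_ psi 3).
Proof.
have K := wavelet_kernel d psi hpsi.
have D0 := Delta_gt0 d hd0; have D1 := Delta_lt d hd0 hd1.
have pi0 := @pi_gt0 R.
(* The factor [2 * pi * eta] is [pi * (4 * D)], and [4 * D < 1]. *)
have eta1 (I : R) : 0 <= I -> 2 * pi * `|eta| * I <= pi * I.
  move=> I0; rewrite ler_wpM2r// ger0_norm; last by lra.
  have : pi * (4 * D) <= pi * 1 by rewrite ler_pM2l// ltW.
  lra.
have M2 : Int (fun s => `|s| * `|s| * w s) = I_ psi 2.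
  by rewrite I_E; apply: Int_eq => s; rewrite -expr2.
have M3 : Int (fun s => s ^+ 2 * `|s| * w s) = I_ psi 3.
  by rewrite I_E; apply: Int_eq => s; rewrite (exprSr _ 2) real_normK ?num_real.
apply: approx_error_le => //.
- apply: le_trans (eta1 _ (I_ge0 psi 2)); rewrite -M2.
  apply: (modulated_moment_le _ _ _ _ K) => //.
    exact: kernel_integ1 K.
  by apply: integ_eq (wavelet_moment_integ d psi hpsi 2) => s; rewrite -expr2.
- apply: le_trans (eta1 _ (I_ge0 psi 3)); rewrite -M3.
  apply: (modulated_moment_le _ _ _ _ K) => [s||].
  + exact: sqr_ge0.
  + exact: kernel_integ2 K.
  + apply: integ_eq (wavelet_moment_integ d psi hpsi 3) => s.
    by rewrite (exprSr _ 2) real_normK ?num_real.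
Qed.

(** At the scale of component [l], other frequencies of its own representation are at relative
    distance at least [4 * D], and unmatched ones of the other representation at least [3 * D]. [Hm]
    vanishes at both, and equals [psi_hat d] at the matched pair. *)
Lemma matched_projection (f : R -> R) (n m : nat) (a phi : 'I_n -> R -> R)
    (A vphi : 'I_m -> R -> R) (b : R) (l : 'I_n) (k : 'I_m) (u v : R) :
  repr_in_A_eps_d c1 c2 eps d f a phi ->
  repr_in_A_eps_d c1 c2 eps d f A vphi ->
  close_to D (derive1 (phi l) b) (derive1 (vphi k) b) ->
  u ^+ 2 + v ^+ 2 = 1 ->
  `|a l b * (u * cos (2 * pi * phi l b) - v * sin (2 * pi * phi l b)) -
    A k b * (u * cos (2 * pi * vphi k b) - v * sin (2 * pi * vphi k b)) *
      psi_hat d (derive1 (vphi k) b / derive1 (phi l) b)| <=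
  2 * (n%:R + m%:R) * modulated_error.
Proof.
move=> r1 r2 close uv.
have D0 := Delta_gt0 d hd0; have D1 := Delta_lt d hd0 hd1.
have /andP[x1 x2] := repr_frequency_bounds r1 l b.
have x0 : 0 < derive1 (phi l) b by exact: lt_trans hc1 x1.
have := transform_difference _ _ _ _ _ _ _ _ _ _ _ _ _ _ _
  u v b (derive1 (phi l) b)
  (modulated_kernel _ _ _ _ (wavelet_kernel d psi hpsi) eta)
  modulated_hat_neg hc1 heps uv x1 r1 r2.
rewrite (sum_eq_single _ _ l); last first.
  move=> i il; rewrite modulated_hat_far ?mulr0//.
  have := gapped_far D n (fun k => derive1 (phi k) b) i l D0 D1
    (fun k => repr_frequency_gt0 r1 k b hc1) (repr_gapped r1 b hd0 hd1 hc1) il.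
  by have ? := D0 => h; apply: le_trans h; lra.
rewrite (sum_eq_single _ _ k); last first.
  move=> i ik; rewrite modulated_hat_far ?mulr0//.
  exact: (gapped_far_close D m (fun k => derive1 (vphi k) b) i k _ D0 D1
    (fun k => repr_frequency_gt0 r2 k b hc1) (repr_gapped r2 b hd0 hd1 hc1) ik x0 close).
rewrite divff ?gt_eqF// (modulated_hat_close 1) ?subrr ?normr0//.
by rewrite (modulated_hat_close (_ / _))// (psi_hat1 d hd0) mulr1.
Qed.

End Stages.

(** * Landau's inequality, constants and final estimates *)

(** Landau's inequality with a free step [h]. Subtracting the expansions at [t + h] and [t - h]
    cancels [g t], so that only [2 * m0] is lost over a length [2 * h]. *)
Lemma derivative_bound_of_bounded {R : realType} (g dg : R -> R) (M m0 h : R) :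
  (forall t : R, is_derive t (1 : R) g (dg t)) ->
  (forall x y : R, `|dg x - dg y| <= M * `|x - y|) ->
  (forall t, `|g t| <= m0) -> 0 < h ->
  forall t, `|dg t| <= m0 / h + M * h / 2.
Proof.
move=> gdg dgM gm h0 t.
have T1 := second_order_taylor g dg M gdg dgM t h.
have T2 := second_order_taylor g dg M gdg dgM t (- h).
have := gm (t + h); have := gm (t - h).
move: T1 T2; rewrite sqrrN !ler_norml.
move=> /andP[a1 a2] /andP[a3 a4] /andP[a5 a6] /andP[a7 a8].
have E : (m0 / h + M * h / 2) * h = m0 + M * h ^+ 2 / 2.
  by field; rewrite gt_eqF.
apply/andP; split.
- by rewrite -(ler_pM2r h0) mulNr E; lra.
- by rewrite -(ler_pM2r h0) E; lra.
Qed.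

(* The third argument of the maximum in [E_I], with the factor
   sqrt c2 / c1^(3/2) weakened to 1 / c1. *)
Definition lower_E_I {R : realType} (c1 c2 K0 I1 I2 I3 : R) : R :=
  9 * (c2 / c1) * K0 *
  (I1 + I2 / (2 * c1) +
   pi * (c2 / c1 * I2 + c2 / (3 * c1 ^+ 2) * I3)).

(** The weakening rests on [sqrt c2 / c1^(3/2) = sqrt (c2 / c1) / c1 >= 1 / c1]. *)
Lemma lower_E_I_le {R : realType} (c1 c2 d : R) (psi : R -> R[i]) :
  0 < c1 -> c1 < c2 ->
  0 <= (Num.ceil ((ln c2 - ln c1) / (ln (1 + d) - ln (1 - d))))%:~R :> R ->
  lower_E_I c1 c2
    (Num.ceil ((ln c2 - ln c1) / (ln (1 + d) - ln (1 - d))))%:~R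
    (I_ psi 1) (I_ psi 2) (I_ psi 3) <= E_I c1 c2 d psi.
Proof.
move=> c10 c12 K0.
apply: (@le_trans _ _ (9 * Num.sqrt c2 * E_m c1 c2 d psi)); last first.
  by rewrite /E_I !le_max lexx !orbT.
rewrite /lower_E_I /E_m.
set C := _%:~R in K0 *; set B := (_ + pi * _).
have B0 : 0 <= B.
  have i1 := I_ge0 psi 1; have i2 := I_ge0 psi 2; have i3 := I_ge0 psi 3.
  have c20 : 0 < c2 by exact: lt_trans c12.
  have pi0 := @pi_ge0 R.
  have f1 : 0 <= I_ psi 2 / (2 * c1) by rewrite divr_ge0// mulr_ge0// ltW.
  have f2 : 0 <= c2 / c1 * I_ psi 2 by rewrite mulr_ge0// divr_ge0// ltW.
  have f3 : 0 <= c2 / (3 * c1 ^+ 2) * I_ psi 3.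
    by rewrite mulr_ge0// divr_ge0 ?(ltW c20)// mulr_ge0// sqr_ge0.
  by rewrite /B addr_ge0 ?addr_ge0// mulr_ge0// addr_ge0.
have s0 : 0 < Num.sqrt c1 by rewrite sqrtr_gt0.
have E : c1 `^ (3 / 2) = c1 * Num.sqrt c1.
  have -> : (3 / 2 : R) = 1 + 2^-1 by lra.
  rewrite powRD; last by rewrite (gt_eqF c10) implybT.
  by rewrite powRr1 ?powR12_sqrt// ltW.
have key : c2 / c1 <= Num.sqrt c2 * (c2 / c1 `^ (3 / 2)).
  rewrite E invfM !mulrA -(ler_pM2r s0) mulfVK ?gt_eqF//.
  have -> : Num.sqrt c2 * c2 / c1 = c2 / c1 * Num.sqrt c2 by ring.
  rewrite ler_wpM2l ?divr_ge0 ?ltW//; first exact: lt_trans c12.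
  by rewrite ltr_sqrt// (lt_trans c10).
have -> : 9 * Num.sqrt c2 * (c2 / c1 `^ (3 / 2) * C * B) =
  Num.sqrt c2 * (c2 / c1 `^ (3 / 2)) * (9 * C * B) by ring.
have -> : 9 * (c2 / c1) * C * B = c2 / c1 * (9 * C * B) by ring.
by rewrite ler_wpM2r// !mulr_ge0.
Qed.

(** In the notation of the proof, [Q * eps = 9 * K0 * T * (G + F)], where [G] comes from the bound
    on [e] by moments of orders 1 and 2 and [F] controls the one by orders 2 and 3. The first
    conclusion costs 8 of the 9 available units of [K0 * T * G]. *)
Lemma error_constants {R : realType} (c1 c2 eps n K0 I1 I2 I3 e : R) :
  0 < c1 -> c1 < c2 -> 0 < eps -> 1 <= n -> n <= K0 ->
  1 / 4 <= I1 -> 0 <= I2 -> 0 <= I3 ->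
  e <= approx_error c1 c2 eps (2 * I1) (2 * I2) ->
  e <= approx_error c1 c2 eps (pi * I2) (pi * I3) ->
  let Q := lower_E_I c1 c2 K0 I1 I2 I3 in
  let dl := 4 * n * e in
  [/\ dl <= Q * eps,
      5 / 4 * (dl / c1) / (2 * pi) <= Q * eps &
      4 * c2 * (5 / 4 * (dl / c1) / (2 * pi)) <= eps * Q ^+ 2].
Proof.
move=> c10 c12 eps0 n1 nK i1 i2 i3 e1 e2 Q dl.
have c20 : 0 < c2 by lra.
have pi2 := @pi_ge2 R.
have pi0 : 0 < pi :> R by lra.
have [rho rhoE] : exists rho, rho = c2 / c1 by exists (c2 / c1).
have rho0 : 0 < rho by rewrite rhoE divr_gt0.
pose G := I1 + pi * rho * I2.
pose W := I2 + pi * rho * I3.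
pose F := (I2 / 2 + pi * rho * I3 / 3) / c1.
have prI2 : 0 <= pi * rho * I2 by rewrite !mulr_ge0 ?(ltW pi0) ?(ltW rho0).
have prI3 : 0 <= pi * rho * I3 by rewrite !mulr_ge0 ?(ltW pi0) ?(ltW rho0).
have G0 : 1 / 4 <= G by rewrite /G; lra.
have F0 : 0 <= F by rewrite /F divr_ge0 ?(ltW c10)//; lra.
have QE : Q = 9 * rho * K0 * (G + F).
  by rewrite /Q /lower_E_I /G /F rhoE; field; rewrite gt_eqF.
(* The coefficients 1/2 and 1/3 inside [F] become 3/2 and 1, which dominate those of [W]. *)
have WF : W / c1 <= 3 * F.
  by rewrite /F mulrA ler_wpM2r ?invr_ge0 ?(ltW c10)// /W; lra.
have [T TE] : exists T, T = eps * rho by exists (eps * rho).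
have T0 : 0 < T by rewrite TE mulr_gt0.
have e1' : e <= 2 * (T * G) by move: e1; rewrite /approx_error -rhoE -TE /G; lra.
have e2' : e <= T * pi * W by move: e2; rewrite /approx_error -rhoE -TE /W; lra.
have n0 : 0 < n by lra.
have TG0 : 0 <= T * G by rewrite mulr_ge0 ?(ltW T0)//; lra.
have nK' (x : R) : 0 <= x -> n * x <= K0 * x by move=> x0; rewrite ler_wpM2r.
have TF0 : 0 <= T * F by rewrite mulr_ge0 ?(ltW T0).
have QTE : Q * eps = 9 * (K0 * (T * G)) + 9 * (K0 * (T * F)) by rewrite QE TE; ring.
have ne1 : n * e <= 2 * (n * (T * G)).
  have : n * e <= n * (2 * (T * G)) by rewrite ler_wpM2l// ltW.
  lra.
have KG := nK' _ TG0; have KF := nK' _ TF0.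
have nTG0 : 0 <= n * (T * G) by rewrite mulr_ge0 ?(ltW n0).
have nTF0 : 0 <= n * (T * F) by rewrite mulr_ge0 ?(ltW n0).
split.
- by rewrite QTE /dl; lra.
(* Here the bound by [W] is used, since [F] already contains the division by [c1]; the quantity to
   estimate is then at most [15/2] times [n * T * F]. *)
- have h : n * e / c1 <= 3 * pi * (n * (T * F)).
    have -> : 3 * pi * (n * (T * F)) = n * T * pi * (3 * F) by ring.
    apply: (@le_trans _ _ (n * T * pi * (W / c1))); last first.
      by rewrite ler_wpM2l// !mulr_ge0 ?(ltW n0) ?(ltW T0) ?(ltW pi0).
    have -> : n * T * pi * (W / c1) = n * (T * pi * W) / c1 by ring.
    by rewrite ler_wpM2r ?invr_ge0 ?(ltW c10)// ler_wpM2l ?(ltW n0).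
  rewrite ler_pdivrMr ?mulr_gt0// QTE /dl.
  have -> : 5 / 4 * (4 * n * e / c1) = 5 * (n * e / c1) by field; rewrite gt_eqF.
  have p1 : 0 <= pi * (K0 * (T * G)) by rewrite mulr_ge0 ?(ltW pi0)//; lra.
  have p2 : pi * (n * (T * F)) <= pi * (K0 * (T * F)) by rewrite ler_wpM2l ?(ltW pi0).
  have p3 : 0 <= pi * (n * (T * F)) by rewrite mulr_ge0 ?(ltW pi0).
  lra.
(* The left side is linear in [n * G] and the right side quadratic; the lower bound 1/4 on [I1],
   hence on [n * G], closes the comparison. *)
- have -> : 4 * c2 * (5 / 4 * (dl / c1) / (2 * pi)) = 10 * rho * (n * e) / pi.
    by rewrite /dl rhoE; move: pi0; move: (pi : R) => P P0; field; rewrite !gt_eqF.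
  rewrite ler_pdivrMr//.
  have h1 : rho * (n * e) <= rho * (2 * (n * (T * G))) by rewrite ler_wpM2l ?(ltW rho0).
  have nG : 1 / 4 <= n * G.
    have : 1 * G <= n * G by rewrite ler_wpM2r//; lra.
    lra.
  have Qn : 9 * rho * (n * G) <= Q.
    have a1 : n * G <= K0 * G by apply: nK'; lra.
    have a2 : 0 <= K0 * F by rewrite mulr_ge0//; lra.
    have : rho * (n * G) <= rho * (K0 * G + K0 * F)
      by rewrite ler_wpM2l ?(ltW rho0)//; lra.
    rewrite QE; lra.
  have Q2 : (9 * rho * (n * G)) ^+ 2 <= Q ^+ 2.
    rewrite ler_pXn2r ?nnegrE//; last apply: le_trans Qn;
      by rewrite !mulr_ge0 ?(ltW rho0) ?(ltW n0)//; lra.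
  have h2 : eps * (9 * rho * (n * G)) ^+ 2 * 2 <= eps * Q ^+ 2 * pi.
    apply: ler_pM => //; last by rewrite ler_wpM2l ?(ltW eps0).
    by rewrite mulr_ge0 ?sqr_ge0 ?(ltW eps0).
  apply: le_trans h2.
  have -> : eps * (9 * rho * (n * G)) ^+ 2 * 2 = 162 * (rho * (n * (T * G))) * (n * G).
    by rewrite TE; ring.
  have rT0 : 0 <= rho * (n * (T * G)) by rewrite mulr_ge0 ?(ltW rho0).
  have : rho * (n * (T * G)) * (1 / 4) <= rho * (n * (T * G)) * (n * G)
    by rewrite ler_wpM2l.
  lra.
Qed.

Lemma matched_component_estimates {R : realType} (c1 c2 eps d Q e : R)
    (f : R -> R) (n m : nat) (psi : R -> R[i])
    (a phi : 'I_n -> R -> R) (A vphi : 'I_m -> R -> R) (l : 'I_n) (k : 'I_m) :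
  0 < d -> d < 1 -> 0 < c1 -> c1 < c2 -> 0 < eps -> is_wavelet d psi ->
  repr_in_A_eps_d c1 c2 eps d f a phi ->
  repr_in_A_eps_d c1 c2 eps d f A vphi ->
  e = @modulated_error R c1 c2 eps d psi ->
  m = n ->
  (forall b, close_to (Delta d) (derive1 (phi l) b) (derive1 (vphi k) b)) ->
  (forall b, close_to (Delta d) (derive1 (vphi k) b) (derive1 (phi l) b)) ->
  4 * n%:R * e <= c1 / 2 -> 0 < Q ->
  4 * n%:R * e <= Q * eps ->
  5 / 4 * (4 * n%:R * e / c1) / (2 * pi) <= Q * eps ->
  4 * c2 * (5 / 4 * (4 * n%:R * e / c1) / (2 * pi)) <= eps * Q ^+ 2 ->
  exists z : int, forall t : R,
    [/\ `|phi l t - vphi k t - z%:~R| <= Q * eps,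
        `|derive1 (phi l) t - derive1 (vphi k) t| <= Q * eps &
        `|a l t - A k t| <= Q * eps].
Proof.
move=> d0 d1 c10 c12 eps0 hpsi r1 r2 eE mn cl1 cl2 small Q0 q1 q2 q3.
have c20 : 0 < c2 by exact: lt_trans c12.
have pi2 := @pi_ge2 R.
(* With [m = n], the projection error [2 * (n + m) * e] becomes [4 * n * e]. *)
set dl := 4 * n%:R * e in small q1 q2 q3.
set m0 := _ / (2 * pi) in q2 q3.
have hA := repr_component r1 l; have hB := repr_component r2 k.
have psib r : 0 <= psi_hat d r <= 1 by rewrite psi_hat_ge0 psi_hat_le1.
have ptw b : [/\ `|a l b - A k b| <= dl,
    a l b * `|sin (2 * pi * phi l b - 2 * pi * vphi k b)| <= dl &
    0 < cos (2 * pi * phi l b - 2 * pi * vphi k b)].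
  have /andP[a1 a2] := amplitude_bounds hA b.
  have /andP[b1 b2] := amplitude_bounds hB b.
  apply: (amplitude_phase_of_projections _ _ _ _ _ _ _ _
    (psib (derive1 (vphi k) b / derive1 (phi l) b))
    (psib (derive1 (phi l) b / derive1 (vphi k) b))).
  - exact: lt_trans c10 b1.
  - by apply: le_lt_trans small _; lra.
  - move=> u v uv.
    have := matched_projection d0 d1 c10 eps0 hpsi _ _ _ _ _ _ _
      b l k u v r1 r2 (cl1 b) uv.
    by rewrite -eE mn /dl; move=> /le_trans; apply; lra.
  - move=> u v uv.
    have := matched_projection d0 d1 c10 eps0 hpsi _ _ _ _ _ _ _
      b k l u v r2 r1 (cl2 b) uv.
    by rewrite -eE mn /dl; move=> /le_trans; apply; lra.
have dphi := derivable_is_derive1 _ (phase_derivable hA).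
have dvphi := derivable_is_derive1 _ (phase_derivable hB).
have phint b : exists z : int, `|phi l b - vphi k b - z%:~R| <= m0.
  have [_ h2 h3] := ptw b.
  have /andP[a1 a2] := amplitude_bounds hA b.
  have [|||z hz] := @near_integer_of_sin_small R (phi l b - vphi k b) (dl / c1).
  - rewrite mulrBr ler_pdivlMr// mulrC.
    by apply: le_trans h2; rewrite ler_wpM2r// ltW.
  - by rewrite ler_pdivrMr//; lra.
  - by rewrite mulrBr.
  exists z; rewrite /m0 ler_pdivlMr; last by lra.
  by rewrite mulrC.
(* Since [dl / c1 <= 1/2], [m0] is at most [5 / (16 * pi)]. A single integer then serves for all
   times. *)
have m0lt : m0 < 1 / 2.
  rewrite /m0 ltr_pdivrMr; last by lra.
  have : dl / c1 <= 1 / 2 by rewrite ler_pdivrMr//; lra.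
  lra.
have cphi : continuous (fun t => phi l t - vphi k t).
  apply: continuous_of_derivable => t.
  by apply: derivableB; [exact: phase_derivable hA t|exact: phase_derivable hB t].
have [z hz] := close_integer_constant _ _ cphi m0lt phint.
exists z => t; split.
- exact: le_trans (hz t) q2.
- pose g s := phi l s - vphi k s - z%:~R.
  pose dg s := derive1 (phi l) s - derive1 (vphi k) s.
  have gdg s : is_derive s (1 : R) g (dg s).
    have h1 := dphi s; have h2 := dvphi s.
    by rewrite /g; apply: is_derive_eq; rewrite subr0.
  have dgM x y : `|dg x - dg y| <= (2 * eps * c2) * `|x - y|.
    have F1 := frequency_lipschitz hA eps0 x y.
    have F2 := frequency_lipschitz hB eps0 x y.
    have -> : dg x - dg y = (derive1 (phi l) x - derive1 (phi l) y) -
        (derive1 (vphi k) x - derive1 (vphi k) y) by rewrite /dg; ring.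
    by rewrite (le_trans (ler_normB _ _))//; lra.
  (* With this step and Lipschitz constant [2 * eps * c2], the second Landau term is exactly
     [Q * eps / 2], and [q3] says that the first is no larger. *)
  have h0 : 0 < Q / (2 * c2) by rewrite divr_gt0// mulr_gt0.
  have := derivative_bound_of_bounded g dg _ _ _ gdg dgM hz h0 t.
  move=> /le_trans; apply.
  have -> : 2 * eps * c2 * (Q / (2 * c2)) / 2 = Q * eps / 2.
    by field; rewrite gt_eqF.
  suff : m0 / (Q / (2 * c2)) <= Q * eps / 2 by lra.
  rewrite ler_pdivrMr//.
  have -> : Q * eps / 2 * (Q / (2 * c2)) = eps * Q ^+ 2 / (4 * c2).
    by field; rewrite gt_eqF.
  rewrite ler_pdivlMr; first by lra.
  by rewrite mulr_gt0.
- by have [h _ _] := ptw t; exact: le_trans h q1.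
Qed.

(* The phases are compared up to an integer n that does not depend on t: adding
   an integer to a phase changes neither f nor membership in the class. *)
Theorem theorem2p2 (R : realType) (c1 c2 d : R) (psi : R -> R[i])
    (hd0 : 0 < d) (hd1 : d < 1) (hc1 : 0 < c1) (hc12 : c1 < c2)
    (hpsi : is_wavelet d psi) :
  [/\ forall i : nat, (1 <= i <= 3)%N -> absmoment psi i \is a fin_num,
      0 < E_I c1 c2 d psi &
      exists2 eps0 : R, 0 < eps0 &
      forall eps : R, 0 < eps -> eps < eps0 ->
      forall (f : R -> R) (N M : nat) (a phi : 'I_N -> R -> R)
        (A vphi : 'I_M -> R -> R),
      repr_in_A_eps_d c1 c2 eps d f a phi ->
      repr_in_A_eps_d c1 c2 eps d f A vphi ->
      M = N /\
      forall (l : 'I_N) (m : 'I_M), m = l :> nat ->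
        exists n : int, forall t : R,
        [/\ `|phi l t - vphi m t - n%:~R| <= E_I c1 c2 d psi * eps,
            `|derive1 (phi l) t - derive1 (vphi m) t| <= E_I c1 c2 d psi * eps &
            `|a l t - A m t| <= E_I c1 c2 d psi * eps] ].
Proof.
have c20 : 0 < c2 by exact: lt_trans hc12.
have i1 := I1_ge d hd0 hd1 psi hpsi.
have i2 := I_ge0 psi 2; have i3 := I_ge0 psi 3.
pose K0 : R := (Num.ceil ((ln c2 - ln c1) / (ln (1 + d) - ln (1 - d))))%:~R.
have X0 : 0 < (ln c2 - ln c1) / (ln (1 + d) - ln (1 - d)).
  by rewrite divr_gt0// subr_gt0 ltr_ln ?posrE//; lra.
have K00 : 0 < K0 by apply: lt_le_trans X0 _; exact: Num.Theory.ceil_ge.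
have [rho rhoE] : exists rho, rho = c2 / c1 by exists (c2 / c1).
have rho0 : 0 < rho by rewrite rhoE divr_gt0.
have [G GE] : exists G, G = I_ psi 1 + pi * rho * I_ psi 2.
  by exists (I_ psi 1 + pi * rho * I_ psi 2).
have pi0 := @pi_gt0 R.
have G0 : 0 < G.
  have : 0 <= pi * rho * I_ psi 2.
    by apply: mulr_ge0 => //; apply: mulr_ge0; exact: ltW.
  by rewrite GE; lra.
have QE := lower_E_I_le c1 c2 d psi hc1 hc12 (ltW K00).
set Q := lower_E_I _ _ _ _ _ _ in QE.
have Q0 : 0 < Q.
  rewrite /Q /lower_E_I.
  have f2 : 0 <= I_ psi 2 / (2 * c1) by rewrite divr_ge0// mulr_ge0// ltW.
  have f3 : 0 <= c2 / c1 * I_ psi 2 by rewrite mulr_ge0// divr_ge0// ltW.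
  have f4 : 0 <= c2 / (3 * c1 ^+ 2) * I_ psi 3.
    by rewrite mulr_ge0// divr_ge0 ?(ltW c20)// mulr_ge0// sqr_ge0.
  have f5 : 0 <= pi * (c2 / c1 * I_ psi 2 + c2 / (3 * c1 ^+ 2) * I_ psi 3).
    by rewrite mulr_ge0 ?(ltW pi0)// addr_ge0.
  apply: mulr_gt0; last by lra.
  by apply: mulr_gt0 => //; rewrite -rhoE mulr_gt0.
split.
- by move=> i _; exact: absmoment_fin_num d psi hpsi i.
- exact: lt_le_trans QE.
(* The 16 is dictated by [small2]: [4 * N * e <= 8 * K0 * (eps * rho * G)] must stay below [c1 / 2].
   The existence of close frequencies needs only a factor 4. *)
exists (c1 / (16 * K0 * rho * G)).
  by rewrite divr_gt0// !mulr_gt0.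
move=> eps eps0 epslt f N M a phi A vphi r1 r2.
have small : 16 * (K0 * (eps * rho * G)) < c1.
  move: epslt; rewrite ltr_pdivlMr; last by rewrite !mulr_gt0.
  by move=> h; lra.
have NK : N%:R <= K0 by exact: repr_card r1 hd0 hd1 hc1.
have MK : M%:R <= K0 by exact: repr_card r2 hd0 hd1 hc1.
have N1 : 1 <= N%:R :> R by have [h _ _ _] := r1; rewrite ler1n.
have err0 : 0 < eps * rho * G by rewrite !mulr_gt0.
have errE : approx_error c1 c2 eps (I_ psi 1) (I_ psi 2) = eps * rho * G.
  by rewrite /approx_error -rhoE GE.
have Nerr : N%:R * (eps * rho * G) <= K0 * (eps * rho * G) by rewrite ler_wpM2r// ltW.
have Merr : M%:R * (eps * rho * G) <= K0 * (eps * rho * G) by rewrite ler_wpM2r// ltW.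
have K0err : 0 < K0 * (eps * rho * G) by rewrite mulr_gt0.
have D0 := Delta_gt0 d hd0; have D1 := Delta_lt d hd0 hd1.
have matching b := close_matching (Delta d) N M
  (fun k => derive1 (phi k) b) (fun k => derive1 (vphi k) b) D0 D1
  (fun k => repr_frequency_gt0 r1 k b hc1) (fun k => repr_frequency_gt0 r2 k b hc1)
  (repr_gapped r1 b hd0 hd1 hc1) (repr_gapped r2 b hd0 hd1 hc1).
have ex12 b l : exists k, close_to (Delta d) (derive1 (phi l) b) (derive1 (vphi k) b).
  apply: (exists_close_frequency hd0 hd1 hc1 eps0 hpsi f N M a phi A vphi b l r1 r2).
  by rewrite errE; lra.
have ex21 b l : exists k, close_to (Delta d) (derive1 (vphi l) b) (derive1 (phi k) b).
  apply: (exists_close_frequency hd0 hd1 hc1 eps0 hpsi f M N A vphi a phi b l r2 r1).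
  by rewrite errE; lra.
have matching' b := close_matching (Delta d) M N
  (fun k => derive1 (vphi k) b) (fun k => derive1 (phi k) b) D0 D1
  (fun k => repr_frequency_gt0 r2 k b hc1) (fun k => repr_frequency_gt0 r1 k b hc1)
  (repr_gapped r2 b hd0 hd1 hc1) (repr_gapped r1 b hd0 hd1 hc1).
have [MN _] := matching 0 (ex12 0) (ex21 0).
split => // l m ml.
pose e := @modulated_error R c1 c2 eps d psi.
have e1 : e <= approx_error c1 c2 eps (2 * I_ psi 1) (2 * I_ psi 2).
  exact: modulated_error_le2.
have e2 : e <= approx_error c1 c2 eps (pi * I_ psi 2) (pi * I_ psi 3).
  exact: modulated_error_le_pi.
have [q1 q2 q3] := error_constants c1 c2 eps N%:R K0 _ _ _ e
  hc1 hc12 eps0 N1 NK i1 i2 i3 e1 e2.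
have small2 : 4 * N%:R * e <= c1 / 2.
  have e1' : e <= 2 * (eps * rho * G).
    by move: e1; rewrite /approx_error GE -rhoE; lra.
  have : N%:R * e <= N%:R * (2 * (eps * rho * G)) by rewrite ler_wpM2l.
  lra.
have [z hz] := matched_component_estimates c1 c2 eps d Q e f N M psi a phi A vphi l m
  hd0 hd1 hc1 hc12 eps0 hpsi r1 r2 erefl MN
  (fun b => (matching b (ex12 b) (ex21 b)).2 l m ml)
  (fun b => (matching' b (ex21 b) (ex12 b)).2 m l (esym ml))
  small2 Q0 q1 q2 q3.
exists z => t; have [h1 h2 h3] := hz t.
have Qe : Q * eps <= E_I c1 c2 d psi * eps by rewrite ler_wpM2r// ltW.
by split; apply: le_trans Qe.
Qed.
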